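(* There exist path connected, aspherical, separable metric spaces $X$ and $Y$ with $X\subset Y$ (as a subspace) and a point $p\in X$ such that the inclusion $j:X\hookrightarrow Y$ induces a group isomorphism $j^{\ast}:\pi_1(X,p)\to\pi_1(Y,p)$ (thus $j$ induces isomorphisms $\pi_n(X,p)\to\pi_n(Y,p)$ for all $n\ge 1$, i.e. $(X,Y,j)$ satisfies the homotopy-group hypothesis of the Whitehead theorem), but the topological fundamental groups $\pi_1(X,p)$ and $\pi_1(Y,p)$ are not homeomorphic as topological spaces. Hence $X$ and $Y$ do not have the same homotopy type.
   Context: For a metrizable space $Z$ and $p\in Z$, let $C_p(Z)$ be the set of continuous maps $f:[0,1]\to Z$ with $f(0)=f(1)=p$, endowed with the topology of uniform convergence. The topological fundamental group $\pi_1(Z,p)$ is the set of path components of $C_p(Z)$ (i.e. the usual based fundamental group, with group operation induced by concatenation of loops) endowed with the quotient topology under the canonical surjection $q:C_p(Z)\to\pi_1(Z,p)$ sending a loop to its path component; thus $U\subset\pi_1(Z,p)$ is open if and only if $q^{-1}(U)$ is open in $C_p(Z)$. A map $f:Z\to W$ induces the homomorphism $f^{\ast}:\pi_1(Z,p)\to\pi_1(W,f(p))$, $f^{\ast}([\alpha])=[f\circ\alpha]$. A path connected space $Z$ is aspherical if $\pi_n(Z,p)$ is trivial for all $n\ge 2$. *)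

(* Defs.v *)
From HB Require Import structures.
From mathcomp Require Import all_boot all_order all_algebra.
From mathcomp Require Import generic_quotient.
From mathcomp Require Import all_classical all_reals all_analysis.
From mathcomp Require Import wedge_sigT continuous_path.
From mathcomp Require Import lra.

Set Implicit Arguments.
Unset Strict Implicit.
Unset Printing Implicit Defensive.

Import Order.TTheory GRing.Theory Num.Theory.
Import numFieldTopology.Exports numFieldNormedType.Exports.
Local Open Scope classical_set_scope.
Local Open Scope ring_scope.
Local Open Scope quotient_scope.

(** * The unit interval *)

Definition unitI (R : realType) : Type := set_type `[0 : R, 1]%classic.

HB.instance Definition _ (R : realType) :=
  Topological.copy (unitI R) (set_type `[0 : R, 1]%classic).

Definition ival {R : realType} (t : unitI R) : R := set_val t.

Section UnitInterval.
Variable R : realType.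
Implicit Types (t u v : unitI R) (r : R).

Fact clamp_subproof r : Num.max 0 (Num.min 1 r) \in `[0 : R, 1]%classic.
Proof.
rewrite inE /= in_itv /= le_max lexx /= ge_max ler01 /=.
by rewrite ge_min lexx.
Qed.

(* The nearest-point retraction of R onto [0, 1]. *)
Definition clamp r : unitI R :=
  exist (fun x : R => x \in `[0 : R, 1]%classic) _ (clamp_subproof r).

Lemma ival_itv t : 0 <= ival t <= 1.
Proof. by have := set_valP t; rewrite /= in_itv. Qed.

Lemma ival_inj : injective (@ival R).
Proof. by move=> s t; rewrite /ival => st; apply: eq_sig_hprop. Qed.

Lemma ival_clamp r : ival (clamp r) = Num.max 0 (Num.min 1 r).
Proof. by []. Qed.

Lemma clampK r : 0 <= r <= 1 -> ival (clamp r) = r.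
Proof.
move=> /andP[r0 r1]; rewrite ival_clamp.
by rewrite (min_idPr r1) (max_idPr r0).
Qed.

Lemma ivalK t : clamp (ival t) = t.
Proof. by apply: ival_inj; rewrite clampK// ival_itv. Qed.

Lemma ival_continuous : continuous (@ival R).
Proof. exact: (@initial_continuous _ R set_val). Qed.

Lemma to_unitI_continuous (T : topologicalType) (f : T -> unitI R) :
  continuous (ival \o f) -> continuous f.
Proof.
move=> cf; apply/continuousP => A [B oB <-].
by move/continuousP: cf => /(_ B oB).
Qed.

Lemma clamp_continuous : continuous clamp.
Proof.
apply: to_unitI_continuous.
rewrite (_ : ival \o clamp = (cst 0) \max ((cst 1) \min id)); last by [].
move=> x; apply: continuous_max; first exact: cst_continuous.
by apply: continuous_min; [exact: cst_continuous | exact: cvg_id].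
Qed.

Lemma unitI_compact : compact [set: unitI R].
Proof.
have -> : [set: unitI R] = clamp @` `[0, 1]%classic.
  apply/seteqP; split=> // t _; exists (ival t); last exact: ivalK.
  by rewrite /= in_itv /= ival_itv.
apply: continuous_compact; last exact: segment_compact.
exact/continuous_subspaceT/clamp_continuous.
Qed.

Fact unitI_0_neq_1 : clamp 0 != clamp 1.
Proof.
by apply/eqP => /(congr1 ival); rewrite !clampK ?lexx ?ler01// => /eqP;
  rewrite eq_sym oner_eq0.
Qed.

HB.instance Definition _ :=
  @isBiPointed.Build (unitI R) (clamp 0) (clamp 1) unitI_0_neq_1.

Lemma ival_zero : ival (zero : unitI R) = 0.
Proof. by rewrite clampK// lexx ler01. Qed.

Lemma ival_one : ival (one : unitI R) = 1.
Proof. by rewrite clampK// lexx ler01. Qed.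

End UnitInterval.


Lemma paste_continuous (R : realType) (T U : topologicalType) (c : T -> R)
    (a : R) (f g : T -> U) :
  continuous c -> continuous f -> continuous g ->
  (forall x, c x = a -> f x = g x) ->
  continuous (fun x => if c x <= a then f x else g x).
Proof.
move=> cc cf cg fgE; set h := (X in continuous X).
have AB : (c @^-1` [set y | y <= a]) `|` (c @^-1` [set y | a <= y]) = setT.
  apply/seteqP; split=> // x _.
  by have [?|/ltW ?] := leP (c x) a; [left | right].
apply/continuous_subspace_setT; rewrite -AB; apply: withinU_continuous.
- by apply: closed_comp; [move=> ? _; exact: cc | exact: closed_le].
- by apply: closed_comp; [move=> ? _; exact: cc | exact: closed_ge].
- apply: (@subspace_eq_continuous _ _ _ f); last exact: continuous_subspaceT.
  by move=> x; rewrite inE /= /h /from_subspace => ->.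
- apply: (@subspace_eq_continuous _ _ _ g); last exact: continuous_subspaceT.
  move=> x; rewrite inE /= /h /from_subspace => ax.
  case: ifPn => // xa; apply/esym/fgE/eqP.
  by rewrite eq_le xa ax.
Qed.

Lemma pair_continuous (T U V : topologicalType) (f : T -> U) (g : T -> V) :
  continuous f -> continuous g -> continuous (fun x => (f x, g x)).
Proof. by move=> cf cg x; apply: cvg_pair; [exact: cf | exact: cg]. Qed.

Lemma comp_continuous (T U V : topologicalType) (f : T -> U) (g : U -> V) :
  continuous f -> continuous g -> continuous (fun x => g (f x)).
Proof. by move=> cf cg x; apply: continuous_comp; [exact: cf | exact: cg]. Qed.

Section RealContinuity.
Variables (R : realType) (T : topologicalType) (u v : T -> R).
Hypotheses (cu : continuous u) (cv : continuous v).

Lemma addf_continuous : continuous (fun t => u t + v t).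
Proof. by move=> t; apply: (@continuousD _ R^o _ u v); [exact: cu|exact: cv]. Qed.

Lemma subf_continuous : continuous (fun t => u t - v t).
Proof. by move=> t; apply: (@continuousB _ R^o _ u v); [exact: cu|exact: cv]. Qed.

Lemma mulf_continuous : continuous (fun t => u t * v t).
Proof. by move=> t; apply: (@continuousM _ _ u v); [exact: cu|exact: cv]. Qed.

Lemma minf_continuous : continuous (fun t => Num.min (u t) (v t)).
Proof. by move=> t; apply: (@continuous_min _ _ u v); [exact: cu|exact: cv]. Qed.

Lemma maxf_continuous : continuous (fun t => Num.max (u t) (v t)).
Proof. by move=> t; apply: (@continuous_max _ _ u v); [exact: cu|exact: cv]. Qed.

Lemma normf_continuous : continuous (fun t => `|u t|).
Proof. by move=> t; apply: (@cvg_norm _ R^o); exact: cu. Qed.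

End RealContinuity.

Lemma const_continuous (T U : topologicalType) (y : U) :
  continuous (fun _ : T => y).
Proof. by move=> x; exact: cvg_cst. Qed.

Lemma id_continuous (T : topologicalType) : continuous (fun x : T => x).
Proof. by move=> x; exact: cvg_id. Qed.

(** * Path components *)

(* [x] and [y] lie in the same path component of [T]. *)
Definition path_joined (R : realType) (T : topologicalType) (x y : T) : Prop :=
  $|{path unitI R from x to y in T}|.

Section PathJoined.
Variables (R : realType) (T : topologicalType).
Implicit Types x y z : T.

Lemma path_joinedP x y : path_joined R x y <->
  exists h : unitI R -> T, [/\ continuous h, h zero = x & h one = y].
Proof.
split=> [[h]|[h [ch h0 h1]]].
  exists h; split; [exact: cts_fun | exact: path_zero | exact: path_one].
exact: squash (mk_path ch h0 h1 : {path unitI R from x to y in T}).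
Qed.

Lemma path_joined_refl x : path_joined R x x.
Proof. by apply/path_joinedP; exists (cst x); split=> //; exact: cst_continuous. Qed.

Lemma path_joined_sym x y : path_joined R x y -> path_joined R y x.
Proof.
move=> /path_joinedP[h [ch h0 h1]]; apply/path_joinedP.
exists (fun t => h (clamp (1 - ival t))); split.
- apply: (comp_continuous _ ch); apply: (comp_continuous _ (@clamp_continuous R)).
  by apply: subf_continuous; [exact: const_continuous | exact: ival_continuous].
- by rewrite ival_zero subr0.
- by rewrite ival_one subrr.
Qed.

Lemma path_joined_trans y x z :
  path_joined R x y -> path_joined R y z -> path_joined R x z.
Proof.
move=> /path_joinedP[h [ch h0 h1]] /path_joinedP[k [ck k0 k1]].
apply/path_joinedP.
exists (fun t => if ival t <= 2^-1 then h (clamp (2 * ival t))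
                 else k (clamp (2 * ival t - 1))); split.
- have cl : continuous (fun t : unitI R => 2 * ival t).
    apply: mulf_continuous; first exact: const_continuous.
    exact: ival_continuous.
  apply: paste_continuous; first exact: ival_continuous.
  + by apply: (comp_continuous _ ch); apply: (comp_continuous _ (@clamp_continuous R)).
  + apply: (comp_continuous _ ck); apply: (comp_continuous _ (@clamp_continuous R)).
    by apply: subf_continuous => //; exact: const_continuous.
  + by move=> t ->; rewrite divff// subrr [RHS]k0 [LHS]h1.
- by rewrite ival_zero invr_ge0 ler0n mulr0.
- rewrite ival_one ifF; last by apply/negbTE; lra.
  by rewrite mulr1 (_ : 2 - 1 = 1) ?k1//; lra.
Qed.

End PathJoined.

(** * Spaces of based maps and their path components *)

(* What the cubes [0, 1]^n, n >= 1, have in common and the group law of the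
   homotopy groups uses: the boundary, the first coordinate and the update of
   the first coordinate. The two instances below are [0, 1] itself and the
   cubes of functions from 'I_n to [0, 1]. *)
Record cuboid (R : realType) := Cuboid {
  cuboid_space :> topologicalType;
  bd : set cuboid_space;
  coord : cuboid_space -> unitI R;
  upd : unitI R -> cuboid_space -> cuboid_space;
  cuboid_compact : compact [set: cuboid_space];
  coord_continuous : continuous coord;
  upd_continuous :
    continuous (fun tx : unitI R * cuboid_space => upd tx.1 tx.2);
  coordK : forall x, upd (coord x) x = x;
  updK : forall t x, coord (upd t x) = t;
  upd_upd : forall s t x, upd s (upd t x) = upd s x;
  bd_upd0 : forall x, bd (upd zero x);
  bd_upd1 : forall x, bd (upd one x);
  bd_upd : forall x, bd x ->
    [\/ coord x = zero, coord x = one | forall t, bd (upd t x)]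
}.
Arguments bd {R} c.
Arguments coord {R c}.
Arguments upd {R c}.

Section LoopSpace.
Variables (R : realType) (D : cuboid R) (Z : uniformType) (p : Z).

(* Continuous maps sending the boundary to [p], with the topology of uniform
   convergence. *)
Definition based_maps : set {uniform D -> Z} :=
  [set f | continuous (f : D -> Z) /\ forall x, bd D x -> f x = p].

Definition loop_space : Type := set_type based_maps.

HB.instance Definition _ := Topological.copy loop_space (set_type based_maps).

Definition loop_fun (f : loop_space) : D -> Z := set_val f.

Lemma loop_continuous (f : loop_space) : continuous (loop_fun f).
Proof. by have [] := set_valP f. Qed.

Lemma loop_bd (f : loop_space) x : bd D x -> loop_fun f x = p.
Proof. by have [_] := set_valP f; exact. Qed.

Lemma loop_inj (f g : loop_space) : loop_fun f =1 loop_fun g -> f = g.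
Proof. by move=> /funext; rewrite /loop_fun => fg; apply: eq_sig_hprop. Qed.

Fact mk_loop_subproof (f : D -> Z) :
  continuous f -> (forall x, bd D x -> f x = p) ->
  (f : {uniform D -> Z}) \in based_maps.
Proof. by move=> cf fp; rewrite inE. Qed.

Definition mk_loop f cf fp : loop_space :=
  exist (fun f : {uniform D -> Z} => f \in based_maps) f
    (@mk_loop_subproof f cf fp).

(* A path in [loop_space] is a homotopy relative to the boundary. *)
Lemma path_joined_homotopyP (f g : loop_space) : path_joined R f g <->
  exists H : unitI R * D -> Z, [/\ continuous H,
    forall x, H (zero, x) = loop_fun f x,
    forall x, H (one, x) = loop_fun g x &
    forall s x, bd D x -> H (s, x) = p].
Proof.
split=> [/path_joinedP[h [ch h0 h1]]|[H [cH H0 H1 Hp]]].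
  exists (fun sx => loop_fun (h sx.1) sx.2); split => //=.
  - move=> [s0 x0] /=; apply/cvg_app_entourageP => E entE.
    have /= ux : nbhs (loop_fun (h s0) : {uniform D -> Z})
       [set k | forall y, [set: D] y ->
          split_ent E (loop_fun (h s0) y, k y)].
      apply/uniform_nbhs; exists (split_ent E); split.
        exact: entourage_split_ent.
      by [].
    have hs : \forall s \near s0,
        forall y, split_ent E (loop_fun (h s0) y, loop_fun (h s) y).
      have cv : continuous (fun s => set_val (h s) : {uniform D -> Z}).
        move=> s; apply: (@continuous_comp _ _ _ h set_val); first exact: ch.
        exact: initial_continuous.
      have := cv s0 _ ux; rewrite nbhs_simpl /= .
      by apply: filterS => s us y; exact: us.
    have hx : \forall x \near x0,
        split_ent E (loop_fun (h s0) x0, loop_fun (h s0) x).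
      have /cvg_app_entourageP := @loop_continuous (h s0) x0.
      by apply; exact: entourage_split_ent.
    exists ([set s | forall y, split_ent E (loop_fun (h s0) y, loop_fun (h s) y)],
            [set x | split_ent E (loop_fun (h s0) x0, loop_fun (h s0) x)]) => //.
    move=> [s x] /= [hsx hx0].
    exact: (entourage_split _ entE hx0 (hsx x)).
  - by rewrite h0.
  - by rewrite h1.
  - by move=> s x bx; rewrite loop_bd.
have cHs s : continuous (fun x => H (s, x)).
  apply: (@comp_continuous _ _ _ (fun x => (s, x)) H) => //.
  by apply: pair_continuous => ?; [exact: cvg_cst | exact: cvg_id].
pose h s := mk_loop (cHs s) (Hp s).
apply/path_joinedP; exists h; split.
- suff ch : continuous (fun s => set_val (h s) : {uniform D -> Z}).
    apply/continuousP => _ [B oB <-].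
    by move/continuousP: ch => /(_ B oB).
  move=> s0 P /uniform_nbhs[E [entE subP]].
  suff : \forall s \near s0, forall y, [set: D] y -> E (H (s0, y), H (s, y)).
    by apply: filterS => s Es; apply: subP.
  have /compact_near_coveringP := @cuboid_compact R D.
  move=> /(_ _ (nbhs s0) (fun s y => E (H (s0, y), H (s, y)))).
  apply=> y _.
  have /cvg_app_entourageP /(_ _ (entourage_invI (entourage_split_ent entE))) :=
    cH (s0, y).
  move=> [[S Y] /= [Ss Yy] SY].
  exists (Y, S) => // -[x s] /= [Yx Sx].
  apply: (entourage_split (H (s0, y))) => //.
    by have [] := SY (s0, x) (conj (nbhs_singleton Ss) Yx).
  by have [] := SY (s, x) (conj Sx Yx).
- by apply: loop_inj => x; exact: H0.
- by apply: loop_inj => x; exact: H1.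
Qed.


Definition loop_cst : loop_space := 
  mk_loop (@const_continuous D Z p) (fun _ _ => erefl).

(* f(2t, x') for t <= 1/2 and g(2t - 1, x') for t > 1/2. *)
Definition concat_fun (f g : D -> Z) (x : D) : Z :=
  if ival (coord x) <= 2^-1 then f (upd (clamp (2 * ival (coord x))) x)
  else g (upd (clamp (2 * ival (coord x) - 1)) x).

Definition reverse_fun (f : D -> Z) (x : D) : Z :=
  f (upd (clamp (1 - ival (coord x))) x).

Lemma upd_comp_continuous (T : topologicalType) (u : T -> R) (h : T -> D) :
  continuous u -> continuous h -> continuous (fun t => upd (clamp (u t)) (h t)).
Proof.
move=> cu ch.
apply: (@comp_continuous _ _ _ (fun t => (clamp (u t), h t)) (fun tx => upd tx.1 tx.2)).
  apply: pair_continuous => //.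
  exact: (@comp_continuous _ _ _ u (@clamp R) cu (@clamp_continuous R)).
exact: upd_continuous.
Qed.

Lemma icoord_continuous : continuous (fun x : D => ival (coord x)).
Proof.
apply: (@comp_continuous _ _ _ (@coord R D) (@ival R)).
  exact: coord_continuous.
exact: ival_continuous.
Qed.

Lemma concat_homotopy_continuous (T : topologicalType) (F G : T * D -> Z) :
  continuous F -> continuous G ->
  (forall t x, bd D x -> F (t, x) = p) -> (forall t x, bd D x -> G (t, x) = p) ->
  continuous (fun tx : T * D =>
    concat_fun (fun x => F (tx.1, x)) (fun x => G (tx.1, x)) tx.2).
Proof.
move=> cF cG Fp Gp.
have c1 : continuous (fun tx : T * D => tx.1) by move=> ?; exact: cvg_fst.
have c2 : continuous (fun tx : T * D => tx.2) by move=> ?; exact: cvg_snd.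
have cc : continuous (fun tx : T * D => ival (coord tx.2)).
  exact: (comp_continuous c2 icoord_continuous).
have cl : continuous (fun tx : T * D => 2 * ival (coord tx.2)).
  by apply: mulf_continuous => //; exact: const_continuous.
apply: (@paste_continuous _ _ _ (fun tx : T * D => ival (coord tx.2)) _
  (fun tx => F (tx.1, upd (clamp (2 * ival (coord tx.2))) tx.2))
  (fun tx => G (tx.1, upd (clamp (2 * ival (coord tx.2) - 1)) tx.2))) => //.
- apply: (comp_continuous _ cF); apply: pair_continuous => //.
  exact: upd_comp_continuous.
- apply: (comp_continuous _ cG); apply: pair_continuous => //.
  apply: upd_comp_continuous => //.
  by apply: subf_continuous => //; exact: const_continuous.
- move=> [t x] /= ->; rewrite divff// subrr Fp ?Gp//; first exact: bd_upd0.
  exact: bd_upd1.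
Qed.

Lemma concat_bd (f g : D -> Z) :
  (forall x, bd D x -> f x = p) -> (forall x, bd D x -> g x = p) ->
  forall x, bd D x -> concat_fun f g x = p.
Proof.
move=> fp gp x bx; rewrite /concat_fun.
case: (bd_upd bx) => [x0|x1|bux].
- rewrite x0 ival_zero invr_ge0 ler0n mulr0; apply: fp; exact: bd_upd0.
- rewrite x1 ival_one ifF; last by apply/negbTE; lra.
  by rewrite mulr1 (_ : 2 - 1 = 1); [apply: gp; exact: bd_upd1 | lra].
- by case: ifP => _; [apply: fp | apply: gp].
Qed.

Fact concat_subproof (f g : loop_space) :
  continuous (concat_fun (loop_fun f) (loop_fun g)).
Proof.
have ch (h : loop_space) : continuous (fun tx : D * D => loop_fun h tx.2).
  apply: comp_continuous; last exact: loop_continuous.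
  by move=> ?; exact: cvg_snd.
have hp (h : loop_space) (t x : D) : bd D x -> loop_fun h (t, x).2 = p.
  exact: loop_bd.
have := concat_homotopy_continuous (ch f) (ch g) (hp f) (hp g).
apply: (@comp_continuous _ _ _ (fun x => (x, x))).
by apply: pair_continuous => ?; exact: cvg_id.
Qed.

Definition concat (f g : loop_space) : loop_space :=
  mk_loop (@concat_subproof f g) (concat_bd (@loop_bd f) (@loop_bd g)).

Fact reverse_subproof (f : loop_space) : continuous (reverse_fun (loop_fun f)).
Proof.
apply: (comp_continuous _ (@loop_continuous f)).
apply: upd_comp_continuous; last exact: id_continuous.
by apply: subf_continuous; [exact: const_continuous | exact: icoord_continuous].
Qed.

Lemma reverse_bd (f : D -> Z) : (forall x, bd D x -> f x = p) ->
  forall x, bd D x -> reverse_fun f x = p.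
Proof.
move=> fp x bx; apply: fp; case: (bd_upd bx) => [->|->|//].
- by rewrite ival_zero subr0; exact: bd_upd1.
- by rewrite ival_one subrr; exact: bd_upd0.
Qed.

Definition reverse (f : loop_space) : loop_space :=
  mk_loop (@reverse_subproof f) (reverse_bd (@loop_bd f)).

Lemma concat_joined (f f' g g' : loop_space) :
  path_joined R f f' -> path_joined R g g' ->
  path_joined R (concat f g) (concat f' g').
Proof.
move=> /path_joined_homotopyP[F [cF F0 F1 Fp]].
move=> /path_joined_homotopyP[G [cG G0 G1 Gp]].
apply/path_joined_homotopyP; exists (fun sx =>
  concat_fun (fun x => F (sx.1, x)) (fun x => G (sx.1, x)) sx.2); split.
- exact: concat_homotopy_continuous.
- by move=> x /=; rewrite /concat_fun !F0 !G0.
- by move=> x /=; rewrite /concat_fun !F1 !G1.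
- move=> s x bx; apply: concat_bd bx => y yb /=; [exact: Fp | exact: Gp].
Qed.

(* Loops obtained from [f] by reparametrizations of the first coordinate with
   the same endpoints are joined, by the straight-line homotopy. *)
Lemma reparam_joined (f k l : loop_space) (u v : R -> R) :
  continuous u -> continuous v ->
  (forall r, 0 <= r <= 1 -> 0 <= u r <= 1) ->
  (forall r, 0 <= r <= 1 -> 0 <= v r <= 1) ->
  u 0 = v 0 -> u 1 = v 1 -> u 0 = 0 \/ u 0 = 1 -> u 1 = 0 \/ u 1 = 1 ->
  (forall x, loop_fun k x = loop_fun f (upd (clamp (u (ival (coord x)))) x)) ->
  (forall x, loop_fun l x = loop_fun f (upd (clamp (v (ival (coord x)))) x)) ->
  path_joined R k l.
Proof.
move=> cu cv u01 v01 uv0 uv1 u0 u1 kE lE.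
have b01 r x : r = 0 \/ r = 1 -> bd D (upd (clamp r) x).
  by case=> ->; [exact: bd_upd0 | exact: bd_upd1].
apply/path_joined_homotopyP.
pose w (sx : unitI R * D) : R := u (ival (coord sx.2)) +
  ival sx.1 * (v (ival (coord sx.2)) - u (ival (coord sx.2))).
have c1 : continuous (fun tx : unitI R * D => ival tx.1).
  apply: (@comp_continuous _ _ _ _ (@ival R)); last exact: ival_continuous.
  by move=> ?; exact: cvg_fst.
have c2 : continuous (fun tx : unitI R * D => tx.2) by move=> ?; exact: cvg_snd.
have cc := comp_continuous c2 icoord_continuous.
have cuc := comp_continuous cc cu.
have cvc := comp_continuous cc cv.
have cw : continuous w.
  by apply: addf_continuous => //; apply: mulf_continuous => //;
    exact: subf_continuous.
exists (fun sx => loop_fun f (upd (clamp (w sx)) sx.2)); split.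
- apply: (comp_continuous _ (@loop_continuous f)).
  exact: upd_comp_continuous.
- by move=> x; rewrite /w /= ival_zero mul0r addr0 kE.
- by move=> x; rewrite /w /= ival_one mul1r addrC subrK lE.
- move=> s x bx; apply: loop_bd => /=; case: (bd_upd bx) => [x0|x1|//].
  + by rewrite /w /= x0 ival_zero -uv0 subrr mulr0 addr0; exact: b01.
  + by rewrite /w /= x1 ival_one -uv1 subrr mulr0 addr0; exact: b01.
Qed.

Lemma loop_eq_upd (f : loop_space) x r s :
  r = s -> loop_fun f (upd (clamp r) x) = loop_fun f (upd (clamp s) x).
Proof. by move=> ->. Qed.

Lemma concat_fun_upd (f g : D -> Z) r x : 0 <= r <= 1 ->
  concat_fun f g (upd (clamp r) x) =
  if r <= 2^-1 then f (upd (clamp (2 * r)) x)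
  else g (upd (clamp (2 * r - 1)) x).
Proof. by move=> r01; rewrite /concat_fun !updK !upd_upd clampK. Qed.

Lemma coord_upd_id x : upd (clamp (ival (coord x))) x = x :> D.
Proof. by rewrite ivalK coordK. Qed.

Lemma concatA_joined (f g h : loop_space) :
  path_joined R (concat f (concat g h)) (concat (concat f g) h).
Proof.
apply: path_joined_sym.
pose u (r : R) : R := Num.min (2 * r) (Num.min (r + 4^-1) ((r + 1) / 2)).
have uE r : 0 <= r <= 1 -> u r = if r <= 4^-1 then 2 * r else
    if r <= 2^-1 then r + 4^-1 else (r + 1) / 2.
  move=> /andP[r0 r1]; rewrite /u.
  rewrite /Order.min; do !case: ifPn; rewrite -?leNgt -?ltNge; lra.
have cu : continuous u.
  have ci : continuous (fun r : R => r) := @id_continuous R.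
  have cc a : continuous (fun _ : R => a : R) := @const_continuous _ _ a.
  by apply: minf_continuous; [exact: mulf_continuous|];
     apply: minf_continuous; [exact: addf_continuous|];
     apply: mulf_continuous => //; exact: addf_continuous.
have u01 r : 0 <= r <= 1 -> 0 <= u r <= 1.
  by move=> r01; rewrite uE//; do 2?case: ifPn; rewrite -?ltNge; lra.
have u0 : u 0 = 0.
  by rewrite uE ?lexx ?ler01// mulr0; case: ifPn => //; rewrite -ltNge; lra.
have u1 : u 1 = 1.
  by rewrite uE ?lexx ?ler01//; do 2?case: ifPn; rewrite -?ltNge; lra.
apply: (@reparam_joined (concat f (concat g h)) _ _ u id) => //.
- exact: id_continuous.
- by left.
- by right.
- move=> x; rewrite -{1}[x]coord_upd_id; have := ival_itv (coord x).
  set r := ival (coord x) => /[dup] r01 /andP[r0 r1].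
  rewrite [LHS]concat_fun_upd// [RHS]concat_fun_upd ?u01//.
  have [r2|r2] := leP r 2^-1.
    rewrite [LHS]concat_fun_upd; last by lra.
    have [r4|r4] := leP r 4^-1.
      have ur : u r = 2 * r by rewrite uE// r4.
      rewrite ifT; last by lra.
      rewrite ifT; last by rewrite ur; lra.
      by apply: loop_eq_upd; rewrite ur.
    have ur : u r = r + 4^-1 by rewrite uE// r2 (lt_geF r4).
    rewrite ifF; last by apply/negbTE; lra.
    rewrite ifF; last by apply/negbTE; rewrite ur; lra.
    rewrite [RHS]concat_fun_upd; last by rewrite ur; lra.
    rewrite ifT; last by rewrite ur; lra.
    by apply: loop_eq_upd; rewrite ur; lra.
  have ur : u r = (r + 1) / 2.
    by rewrite uE// (lt_geF r2) (_ : (r <= 4^-1) = false)//; apply/negbTE; lra.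
  rewrite ifF; last by apply/negbTE; rewrite ur; lra.
  rewrite [RHS]concat_fun_upd; last by rewrite ur; lra.
  rewrite ifF; last by apply/negbTE; rewrite ur; lra.
  by apply: loop_eq_upd; rewrite ur; lra.
- by move=> x; rewrite coord_upd_id.
Qed.

Lemma concat1_joined (f : loop_space) : path_joined R (concat loop_cst f) f.
Proof.
pose u (r : R) : R := Num.max 0 (2 * r - 1).
have cu : continuous u.
  apply: maxf_continuous; first exact: const_continuous.
  apply: subf_continuous; last exact: const_continuous.
  by apply: mulf_continuous; [exact: const_continuous | exact: id_continuous].
apply: (@reparam_joined f _ _ u id) => //.
- exact: id_continuous.
- by move=> r r01; rewrite /u /Order.max; case: ifPn; rewrite -?leNgt; lra.
- by rewrite /u /Order.max; case: ifPn; rewrite -?leNgt; lra.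
- by rewrite /u /Order.max; case: ifPn; rewrite -?leNgt; lra.
- by left; rewrite /u /Order.max; case: ifPn; rewrite -?leNgt; lra.
- by right; rewrite /u /Order.max; case: ifPn; rewrite -?leNgt; lra.
- move=> x; rewrite -{1}[x]coord_upd_id; have := ival_itv (coord x).
  set r := ival (coord x) => /[dup] r01 /andP[r0 r1].
  rewrite [LHS]concat_fun_upd//; case: ifPn; rewrite -?ltNge => r2.
    rewrite (_ : u r = 0); first by rewrite [RHS]loop_bd//; exact: bd_upd0.
    by rewrite /u /Order.max; case: ifPn; lra.
  by apply: loop_eq_upd; rewrite /u /Order.max; case: ifPn; rewrite -?leNgt; lra.
- by move=> x; rewrite coord_upd_id.
Qed.

Lemma concatr1_joined (f : loop_space) : path_joined R (concat f loop_cst) f.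
Proof.
pose u (r : R) : R := Num.min 1 (2 * r).
have cu : continuous u.
  apply: minf_continuous; first exact: const_continuous.
  by apply: mulf_continuous; [exact: const_continuous | exact: id_continuous].
apply: (@reparam_joined f _ _ u id) => //.
- exact: id_continuous.
- by move=> r r01; rewrite /u /Order.min; case: ifPn; rewrite -?leNgt; lra.
- by rewrite /u /Order.min; case: ifPn; rewrite -?leNgt; lra.
- by rewrite /u /Order.min; case: ifPn; rewrite -?leNgt; lra.
- by left; rewrite /u /Order.min; case: ifPn; rewrite -?leNgt; lra.
- by right; rewrite /u /Order.min; case: ifPn; rewrite -?leNgt; lra.
- move=> x; rewrite -{1}[x]coord_upd_id; have := ival_itv (coord x).
  set r := ival (coord x) => /[dup] r01 /andP[r0 r1].
  rewrite [LHS]concat_fun_upd//; case: ifPn; rewrite -?ltNge => r2.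
    by apply: loop_eq_upd; rewrite /u /Order.min; case: ifPn; rewrite -?leNgt; lra.
  rewrite (_ : u r = 1); first by rewrite [RHS]loop_bd//; exact: bd_upd1.
  by rewrite /u /Order.min; case: ifPn; lra.
- by move=> x; rewrite coord_upd_id.
Qed.

Lemma reverse_fun_upd (f : D -> Z) r x : 0 <= r <= 1 ->
  reverse_fun f (upd (clamp r) x) = f (upd (clamp (1 - r)) x).
Proof. by move=> r01; rewrite /reverse_fun updK upd_upd clampK. Qed.

Lemma concatV_joined (f : loop_space) :
  path_joined R (concat (reverse f) f) loop_cst.
Proof.
pose u (r : R) : R := `|1 - 2 * r|.
have cu : continuous u.
  apply: normf_continuous; apply: subf_continuous; first exact: const_continuous.
  by apply: mulf_continuous; [exact: const_continuous | exact: id_continuous].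
have u0 : u 0 = 1 by rewrite /u mulr0 subr0 normr1.
have u1 : u 1 = 1 by rewrite /u mulr1 -normrN (_ : - _ = 1) ?normr1//; lra.
apply: (@reparam_joined f _ _ u (cst 1)) => //.
- exact: const_continuous.
- by move=> r r01; rewrite /u normr_ge0 /= ler_norml; lra.
- by move=> r _ /=; rewrite ler01 lexx.
- by right.
- by right.
- move=> x; rewrite -{1}[x]coord_upd_id; have := ival_itv (coord x).
  set r := ival (coord x) => /[dup] r01 /andP[r0 r1].
  rewrite [LHS]concat_fun_upd//; case: ifPn; rewrite -?ltNge => r2.
    rewrite [LHS]reverse_fun_upd; last by lra.
    by apply: loop_eq_upd; rewrite /u ger0_norm//; lra.
  by apply: loop_eq_upd; rewrite /u ltr0_norm//; lra.
- by move=> x; rewrite [RHS]loop_bd//; exact: bd_upd1.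
Qed.

Lemma concatrV_joined (f : loop_space) :
  path_joined R (concat f (reverse f)) loop_cst.
Proof.
pose u (r : R) : R := 1 - `|1 - 2 * r|.
have cu : continuous u.
  apply: subf_continuous; first exact: const_continuous.
  apply: normf_continuous; apply: subf_continuous; first exact: const_continuous.
  by apply: mulf_continuous; [exact: const_continuous | exact: id_continuous].
have u0 : u 0 = 0 by rewrite /u mulr0 subr0 normr1 subrr.
have u1 : u 1 = 0.
  by rewrite /u mulr1 (_ : 1 - 2 = -1) ?normrN1 ?subrr//; lra.
apply: (@reparam_joined f _ _ u (cst 0)) => //.
- exact: const_continuous.
- move=> r r01; have : `|1 - 2 * r| <= 1 by rewrite ler_norml; lra.
  by have := normr_ge0 (1 - 2 * r); rewrite /u; lra.
- by move=> r _ /=; rewrite ler01 lexx.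
- by left.
- by left.
- move=> x; rewrite -{1}[x]coord_upd_id; have := ival_itv (coord x).
  set r := ival (coord x) => /[dup] r01 /andP[r0 r1].
  rewrite [LHS]concat_fun_upd//; case: ifPn; rewrite -?ltNge => r2.
    by apply: loop_eq_upd; rewrite /u ger0_norm//; lra.
  rewrite [LHS]reverse_fun_upd; last by lra.
  by apply: loop_eq_upd; rewrite /u ltr0_norm//; lra.
- by move=> x; rewrite [RHS]loop_bd//; exact: bd_upd0.
Qed.

Lemma reverse_joined (f g : loop_space) :
  path_joined R f g -> path_joined R (reverse f) (reverse g).
Proof.
move=> /path_joined_homotopyP[F [cF F0 F1 Fp]].
apply/path_joined_homotopyP; exists (fun sx =>
  F (sx.1, upd (clamp (1 - ival (coord sx.2))) sx.2)); split.
- apply: (comp_continuous _ cF); apply: pair_continuous.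
    by move=> ?; exact: cvg_fst.
  have c2 : continuous (fun tx : unitI R * D => tx.2) by move=> ?; exact: cvg_snd.
  apply: upd_comp_continuous => //; apply: subf_continuous.
    exact: const_continuous.
  exact: (comp_continuous c2 icoord_continuous).
- by move=> x; rewrite F0.
- by move=> x; rewrite F1.
- by move=> s x; apply: (@reverse_bd (fun x => F (s, x))); exact: Fp.
Qed.

End LoopSpace.

Arguments based_maps {R} D {Z} p.
Arguments loop_space {R} D {Z} p.
Arguments loop_cst {R D Z p}.

(** * The group of path components of a space of based maps *)

Section HomotopyGroup.
Variables (R : realType) (D : cuboid R) (Z : uniformType) (p : Z).

Definition joined_rel (f g : loop_space D p) : bool := `[< path_joined R f g >].

Fact joined_rel_refl : reflexive joined_rel.
Proof. by move=> f; apply/asboolP; exact: path_joined_refl. Qed.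

Fact joined_rel_sym : symmetric joined_rel.
Proof. by move=> f g; apply/asboolP/asboolP; exact: path_joined_sym. Qed.

Fact joined_rel_trans : transitive joined_rel.
Proof.
move=> g f h /asboolP fg /asboolP gh; apply/asboolP.
exact: path_joined_trans fg gh.
Qed.

Canonical joined_equiv :=
  EquivRel joined_rel joined_rel_refl joined_rel_sym joined_rel_trans.

Definition loop_classes : Type := quotient_topology {eq_quot joined_equiv}.

HB.instance Definition _ :=
  Topological.copy loop_classes (quotient_topology {eq_quot joined_equiv}).

Definition loop_class (f : loop_space D p) : loop_classes :=
  \pi_{eq_quot joined_equiv} f.

Definition loop_repr (a : loop_classes) : loop_space D p :=
  repr (a : {eq_quot joined_equiv}).

Lemma loop_reprK a : loop_class (loop_repr a) = a.
Proof. exact: reprK. Qed.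

Lemma loop_classP f g : loop_class f = loop_class g <-> path_joined R f g.
Proof.
split=> [/eqmodP /asboolP //|fg].
by apply/eqmodP/asboolP.
Qed.

Lemma loop_repr_joined f : path_joined R (loop_repr (loop_class f)) f.
Proof. by apply/loop_classP; rewrite loop_reprK. Qed.

Lemma loop_classes_openE (U : set loop_classes) :
  open U = open (loop_class @^-1` U).
Proof. by []. Qed.

(* The operations are computed on representatives; [classes_mulE] and
   [classes_invE] show that the choice is irrelevant. *)
Definition classes_one : loop_classes := loop_class loop_cst.
Definition classes_mul (a b : loop_classes) : loop_classes :=
  loop_class (concat (loop_repr a) (loop_repr b)).
Definition classes_inv (a : loop_classes) : loop_classes :=
  loop_class (reverse (loop_repr a)).

Lemma classes_mulE f g :
  classes_mul (loop_class f) (loop_class g) = loop_class (concat f g).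
Proof. by apply/loop_classP/concat_joined; exact: loop_repr_joined. Qed.

Lemma classes_invE f : classes_inv (loop_class f) = loop_class (reverse f).
Proof. by apply/loop_classP/reverse_joined; exact: loop_repr_joined. Qed.

Fact classes_mulA : associative classes_mul.
Proof.
move=> a b c; rewrite -[a]loop_reprK -[b]loop_reprK -[c]loop_reprK !classes_mulE.
exact/loop_classP/concatA_joined.
Qed.

Fact classes_mul1 : left_id classes_one classes_mul.
Proof.
move=> a; rewrite -[a]loop_reprK classes_mulE.
exact/loop_classP/concat1_joined.
Qed.

Fact classes_mulr1 : right_id classes_one classes_mul.
Proof.
move=> a; rewrite -[a]loop_reprK classes_mulE.
exact/loop_classP/concatr1_joined.
Qed.

Fact classes_mulV : left_inverse classes_one classes_inv classes_mul.
Proof.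
move=> a; rewrite -[a]loop_reprK classes_invE classes_mulE.
exact/loop_classP/concatV_joined.
Qed.

Fact classes_mulrV : right_inverse classes_one classes_inv classes_mul.
Proof.
move=> a; rewrite -[a]loop_reprK classes_invE classes_mulE.
exact/loop_classP/concatrV_joined.
Qed.

HB.instance Definition _ := isGroup.Build loop_classes
  classes_mulA classes_mul1 classes_mulr1 classes_mulV classes_mulrV.

End HomotopyGroup.
Arguments loop_classes {R} D {Z} p.

Section InducedMap.
Variables (R : realType) (D : cuboid R) (Z W : uniformType).
Variables (phi : continuousType Z W) (p : Z).

Fact loop_map_subproof (f : loop_space D p) : continuous (phi \o loop_fun f).
Proof. exact: comp_continuous (@loop_continuous _ _ _ _ f) (@cts_fun _ _ phi). Qed.

Fact loop_map_bd (f : loop_space D p) x : bd D x -> (phi \o loop_fun f) x = phi p.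
Proof. by move=> bx /=; rewrite loop_bd. Qed.

Definition loop_map (f : loop_space D p) : loop_space D (phi p) :=
  mk_loop (@loop_map_subproof f) (@loop_map_bd f).

Definition classes_map (a : loop_classes D p) : loop_classes D (phi p) :=
  loop_class (loop_map (loop_repr a)).

Lemma classes_mapE f : classes_map (loop_class f) = loop_class (loop_map f).
Proof.
apply/loop_classP/path_joined_homotopyP.
have /path_joined_homotopyP[H [cH H0 H1 Hp]] := loop_repr_joined f.
exists (phi \o H); split => [|x|x|s x bx] /=.
- exact: comp_continuous cH (@cts_fun _ _ phi).
- by rewrite H0.
- by rewrite H1.
- by rewrite Hp.
Qed.

Fact classes_map_is_multiplicative :
  {morph classes_map : a b / (a * b)%g >-> (a * b)%g}.
Proof.
move=> a b; rewrite -[a]loop_reprK -[b]loop_reprK.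
rewrite [(_ * _)%g]classes_mulE !classes_mapE [RHS]classes_mulE.
congr loop_class; apply: loop_inj => x.
set f := loop_repr a; set g := loop_repr b.
rewrite -[LHS]/(phi (concat_fun (loop_fun f) (loop_fun g) x)).
rewrite -[RHS]/(concat_fun (phi \o loop_fun f) (phi \o loop_fun g) x).
by rewrite /concat_fun; case: ifP.
Qed.

HB.instance Definition _ := isMultiplicative.Build _ _ classes_map
  classes_map_is_multiplicative.

End InducedMap.

(** * The cubes *)

Section Interval.
Variable R : realType.

Let ubd : set (unitI R) := [set zero; one].

Fact interval_bd_upd (x : unitI R) : ubd x ->
  [\/ x = zero, x = one | forall t : unitI R, ubd t].
Proof. by case=> ->; [constructor 1 | constructor 2]. Qed.

Definition interval_cuboid : cuboid R :=
  @Cuboid R (unitI R) ubd id (fun t _ => t) (@unitI_compact R)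
    (@id_continuous _) (fun=> cvg_fst) (fun=> erefl) (fun _ _ => erefl)
    (fun _ _ _ => erefl) (fun=> or_introl erefl) (fun=> or_intror erefl)
    interval_bd_upd.

End Interval.

Section Cube.
Variables (R : realType) (n : nat).

Definition cube : Type := prod_topology (fun _ : 'I_n.+1 => unitI R).

HB.instance Definition _ :=
  Topological.copy cube (prod_topology (fun _ : 'I_n.+1 => unitI R)).

Definition cube_bd : set cube := [set x | exists i, x i = zero \/ x i = one].

Definition cube_upd (t : unitI R) (x : cube) : cube :=
  fun i => if i == ord0 then t else x i.

Fact cube_compact : compact [set: cube].
Proof.
have := @tychonoff _ (fun _ : 'I_n.+1 => unitI R) (fun=> setT).
move=> /(_ (fun=> @unitI_compact R)); congr compact.
by apply/seteqP; split.
Qed.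

Fact cube_proj_continuous i : continuous (fun x : cube => x i).
Proof. exact: (@proj_continuous _ (fun _ : 'I_n.+1 => unitI R) i). Qed.

Fact cube_upd_continuous :
  continuous (fun tx : unitI R * cube => cube_upd tx.1 tx.2).
Proof.
have ci i : continuous (fun tx : unitI R * cube => cube_upd tx.1 tx.2 i).
  rewrite /cube_upd; case: (i == ord0) => tx; first exact: cvg_fst.
  apply: (@comp_continuous _ _ _ (fun tx : unitI R * cube => tx.2)
    (fun x : cube => x i)); last exact: cube_proj_continuous.
  by move=> ?; exact: cvg_snd.
move=> tx; apply/cvg_sup => i U [V [[B oB <-] /= Btx] BU].
have nB : nbhs (cube_upd tx.1 tx.2 i) B by exact: open_nbhs_nbhs.
have := ci i tx B nB; rewrite nbhs_simpl /=.
by apply: (@filterS _ (nbhs tx)) => y; exact: BU.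
Qed.

Fact cube_updK t x : cube_upd t x ord0 = t.
Proof. by rewrite /cube_upd eqxx. Qed.

Fact cube_coordK x : cube_upd (x ord0) x = x.
Proof. by apply/funext => i; rewrite /cube_upd; case: eqP => [->|]. Qed.

Fact cube_upd_upd s t x : cube_upd s (cube_upd t x) = cube_upd s x.
Proof. by apply/funext => i; rewrite /cube_upd; case: eqP. Qed.

Fact cube_bd_upd0 x : cube_bd (cube_upd zero x).
Proof. by exists ord0; left; rewrite cube_updK. Qed.

Fact cube_bd_upd1 x : cube_bd (cube_upd one x).
Proof. by exists ord0; right; rewrite cube_updK. Qed.

Fact cube_bd_upd x : cube_bd x ->
  [\/ x ord0 = zero, x ord0 = one | forall t, cube_bd (cube_upd t x)].
Proof.
case=> i; have [->[]|i0 xi] := eqVneq i ord0; [by constructor 1|by constructor 2|].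
by constructor 3 => t; exists i; rewrite /cube_upd (negbTE i0).
Qed.

Definition cube_cuboid : cuboid R :=
  @Cuboid R cube cube_bd (fun x => x ord0) cube_upd cube_compact
    (@cube_proj_continuous ord0) cube_upd_continuous cube_coordK cube_updK
    cube_upd_upd cube_bd_upd0 cube_bd_upd1 cube_bd_upd.

End Cube.

(** * Homotopy groups of a space *)

(* Loops [0, 1] -> Z at p up to path components of the space of loops; the
   topology is the quotient of that of uniform convergence. *)
Definition pi1 (R : realType) (Z : uniformType) (p : Z) : Type :=
  loop_classes (interval_cuboid R) p.

(* pi_n(Z, p) for n >= 1: [cube R m] is [0, 1]^(m.+1), hence the predecessor.
   The value at n = 0 is meaningless. *)
Definition homotopy_group (R : realType) (n : nat) (Z : uniformType) (p : Z) :
    Type :=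
  loop_classes (cube_cuboid R n.-1) p.

Definition pi1_map (R : realType) (Z W : uniformType)
  (phi : continuousType Z W) (p : Z) : pi1 R p -> pi1 R (phi p) :=
  @classes_map R (interval_cuboid R) Z W phi p.

Definition homotopy_group_map (R : realType) (n : nat) (Z W : uniformType)
    (phi : continuousType Z W) (p : Z) :
    homotopy_group R n p -> homotopy_group R n (phi p) :=
  @classes_map R (cube_cuboid R n.-1) Z W phi p.

Definition group_isomorphism (G H : groupType) (h : G -> H) : Prop :=
  bijective h /\ {morph h : a b / (a * b)%g >-> (a * b)%g}.

(** * Topological and homotopical properties *)

Definition path_connected (R : realType) (T : topologicalType) : Prop :=
  forall x y : T, path_joined R x y.

(* For all base points: a path connected space need only be tested at one. *)
Definition aspherical (R : realType) (Z : uniformType) : Prop :=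
  forall (n : nat) (p : Z), (2 <= n)%N ->
  forall a : homotopy_group R n p, a = 1%g.

Definition separable (T : topologicalType) : Prop :=
  exists2 A : set T, countable A & dense A.

Definition homeomorphic (S T : topologicalType) : Prop :=
  exists (f : S -> T) (g : T -> S),
    [/\ continuous f, continuous g, cancel f g & cancel g f].

Definition homotopic (R : realType) (S T : topologicalType) (f g : S -> T) :
    Prop :=
  exists H : unitI R * S -> T, [/\ continuous H,
    forall x, H (zero, x) = f x & forall x, H (one, x) = g x].

Definition homotopy_equivalent (R : realType) (S T : topologicalType) : Prop :=
  exists (f : S -> T) (g : T -> S), [/\ continuous f, continuous g,
    homotopic R (g \o f) id & homotopic R (f \o g) id].

(** * Subsets of a metric space *)

Section MetricSubspace.
Variables (R : realType) (Y : metricType R) (X : set Y).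

Let sdist (x y : X) : R := mdist (set_val x) (set_val y).

Fact sdist_ge0 x y : 0 <= sdist x y.
Proof. exact: mdist_ge0. Qed.

Fact sdist_positivity x y : sdist x y = 0 -> x = y.
Proof. by move=> /mdist_positivity; exact: eq_sig_hprop. Qed.

Fact ballEsdist (x : X) d : ball x d = [set y | sdist x y < d].
Proof. by rewrite -initial_ballE ballEmdist. Qed.

HB.instance Definition _ := PseudoMetric_isMetric.Build R (set_type X)
  sdist_ge0 sdist_positivity ballEsdist.

End MetricSubspace.

HB.instance Definition _ (T : topologicalType) (A : set T) :=
  isContinuous.Build (set_type A) T set_val (@initial_continuous _ T set_val).

Definition inclusion (T : topologicalType) (A : set T) :
  continuousType (set_type A) T := set_val.

(* Main.v *)
(* Let [Y] be the set of points [(r, x, r y, (1 - x) sin (1/r))] of R^4 with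
   [r >= 0] and [x^2 + y^2 = 1], where the last coordinate is [0] for [r = 0], and
   let [X] be its part where [r > 0] or [x = 1]. Thus [Y] is [X] together with a
   segment [J] attached at the base point [p = (0, 1, 0, 0)].

   In the polar coordinates [(r, angle)], [X] is an open half-cylinder with one
   boundary point, so it is a circle up to homotopy: it is aspherical, and nearby
   loops have the same winding number, hence its fundamental groups are discrete.

   As the last coordinate oscillates when [r] tends to [0], no path of [Y] enters
   [J] except through [p]. Shrinking [J] to [p] is therefore continuous on maps
   from locally path connected spaces (though not on [Y]), and the inclusion of
   [X] in [Y] induces isomorphisms of homotopy groups.

   The circles [r = 1/(2 pi n)], on which the last coordinate vanishes, give loops
   of winding number one which converge uniformly to a loop in [J]. The latter is
   null-homotopic, so the fundamental group of [Y] at [p] is not discrete. *)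

Require Import Defs.
From HB Require Import structures.
From mathcomp Require Import all_boot all_order all_algebra.
From mathcomp Require Import all_classical all_reals all_analysis.
From mathcomp Require Import ring lra.

Import Order.TTheory GRing.Theory Num.Theory.
Import numFieldTopology.Exports numFieldNormedType.Exports.
Local Open Scope classical_set_scope.
Local Open Scope ring_scope.

Set Implicit Arguments.
Unset Strict Implicit.
Unset Printing Implicit Defensive.

(** * Tube lemma, intermediate values and connectedness of the interval *)

Lemma compact_near (K T : topologicalType) (P : T -> K -> Prop) (t : T) :
  compact [set: K] ->
  (forall k, @nbhs _ (T * K)%type (t, k) [set z | P z.1 z.2]) ->
  \forall s \near t, forall k, P s k.
Proof.
move=> /compact_near_coveringP /(_ _ (nbhs t) P) cK Pk.
have {}cK : \forall s \near t, [set: K] `<=` P s.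
  apply: cK => k _; have [[S U] /= [St Uk] SU] := Pk k.
  by exists (U, S) => // -[k' s] /= [Uk' Ss]; exact: (SU (s, k')).
by apply: filterS cK => s Ps k; exact: Ps.
Qed.

Lemma unitI_IVT (R : realType) (u : unitI R -> R) (v : R) : continuous u ->
  Num.min (u zero) (u one) <= v <= Num.max (u zero) (u one) ->
  exists t, u t = v.
Proof.
move=> cu uv.
have cuc : {within `[0, 1], continuous (u \o @clamp R)}.
  exact/continuous_subspaceT/(comp_continuous (@clamp_continuous R) cu).
by have [r _ <-] := IVT ler01 cuc uv; exists (clamp r).
Qed.

(** The multiples of 2 pi form a discrete set: if the ends differed, an intermediate value at
    distance in ]0, pi] from one of them would have cosine less than 1. This replaces any handling
    of integer winding numbers below. *)
Lemma cos_eq1_const (R : realType) (u : unitI R -> R) : continuous u ->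
  (forall t, cos (u t) = 1) -> u zero = u one.
Proof.
have main (v : unitI R -> R) : continuous v -> (forall t, cos (v t) = 1) ->
    ~ v zero < v one.
  move=> cv v1 v01.
  have pi0 := pi_gt0 R.
  pose d := Num.min (v one - v zero) pi.
  have d0 : 0 < d by rewrite lt_min subr_gt0 v01.
  have dv : d <= v one - v zero by rewrite ge_min lexx.
  have dpi : d <= pi by rewrite ge_min lexx orbT.
  have [|t vt] := @unitI_IVT R v (v zero + d) cv.
    by rewrite (min_idPl (ltW v01)) (max_idPr (ltW v01)); lra.
  have s0 : sin (v zero) = 0.
    have := cos2Dsin2 (v zero); rewrite v1 expr1n => e.
    by apply/eqP; rewrite -sqrf_eq0; apply/eqP; lra.
  have := v1 t; rewrite vt cosD v1 s0 mul1r mul0r subr0 -cos0.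
  move/cos_inj; rewrite !in_itv /= lexx (ltW pi0) (ltW d0) dpi => /(_ isT isT).
  by move=> dE; rewrite dE ltxx in d0.
move=> cu u1; apply/eqP; rewrite eq_le !leNgt; apply/andP; split; apply/negP.
- rewrite -ltrN2; apply: (@main (fun t => - u t)) => [|t]; last by rewrite cosN.
  by move=> t; apply: (@continuousN _ R^o); exact: cu.
- exact: main.
Qed.

(** Otherwise the indicator function of the failure of [P] would be continuous and skip the value
    1/2. *)
Lemma unitI_locally_constant (R : realType) (P : unitI R -> Prop) :
  (forall a, \forall b \near a, P a <-> P b) -> P zero -> P one.
Proof.
move=> loc P0; apply: contrapT => P1.
pose u t : R := if `[< P t >] then 0 else 1.
have cu : continuous u.
  move=> a U /nbhs_singleton Ua; rewrite nbhs_simpl /=.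
  apply: filterS (loc a) => b ab.
  by rewrite /= /u -(asbool_equiv_eq ab).
have [|t] := @unitI_IVT R u 2^-1 cu.
  rewrite /u asboolT// asboolF// (min_idPl _) ?(max_idPr _) ?ler01//.
  by lra.
by rewrite /u; case: ifP => _; lra.
Qed.

(** The notion serves twice. With one end fixed, [L] contracts the space, which lifts angles; the
    condition on the diagonal gives small paths between nearby points, which the oscillation
    argument needs. *)
Definition equiconnected (R : realType) (T : topologicalType) : Prop :=
  exists L : unitI R * (T * T) -> T, [/\ continuous L,
    forall x y, L (zero, (x, y)) = x,
    forall x y, L (one, (x, y)) = y &
    forall s x, L (s, (x, x)) = x].

(** * Equiconnected spaces and lifting of angles *)

Section Equiconnected.
Variable R : realType.

Lemma unitI_equiconnected : equiconnected R (unitI R).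
Proof.
exists (fun z => clamp ((1 - ival z.1) * ival z.2.1 + ival z.1 * ival z.2.2)).
have c1 : continuous (fun z : unitI R * (unitI R * unitI R) => ival z.1).
  by apply: (comp_continuous _ (@ival_continuous R)) => ?; exact: cvg_fst.
have c2 : continuous (fun z : unitI R * (unitI R * unitI R) => z.2).
  by move=> ?; exact: cvg_snd.
split.
- apply: (comp_continuous _ (@clamp_continuous R)); apply: addf_continuous.
    apply: mulf_continuous; first exact: subf_continuous (@const_continuous _ _ _) c1.
    apply: (comp_continuous _ (@ival_continuous R)); apply: (comp_continuous c2).
    by move=> ?; exact: cvg_fst.
  apply: mulf_continuous => //.
  apply: (comp_continuous _ (@ival_continuous R)); apply: (comp_continuous c2).
  by move=> ?; exact: cvg_snd.
- by move=> x y /=; rewrite ival_zero subr0 mul1r mul0r addr0 ivalK.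
- by move=> x y /=; rewrite ival_one subrr mul0r mul1r add0r ivalK.
- by move=> s x /=; rewrite -mulrDl subrK mul1r ivalK.
Qed.

Lemma prod_equiconnected (S T : topologicalType) :
  equiconnected R S -> equiconnected R T -> equiconnected R (S * T)%type.
Proof.
move=> [L [cL L0 L1 Lx]] [M [cM M0 M1 Mx]].
exists (fun z => (L (z.1, (z.2.1.1, z.2.2.1)), M (z.1, (z.2.1.2, z.2.2.2)))).
split => [|[x x'] [y y']|[x x'] [y y']|s [x x']] /=.
- have c1 : continuous (fun z : unitI R * ((S * T) * (S * T)) => z.1).
    by move=> ?; exact: cvg_fst.
  have c21 : continuous (fun z : unitI R * ((S * T) * (S * T)) => z.2.1).
    by apply: comp_continuous => ?; [exact: cvg_snd | exact: cvg_fst].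
  have c22 : continuous (fun z : unitI R * ((S * T) * (S * T)) => z.2.2).
    by apply: comp_continuous => ?; [exact: cvg_snd | exact: cvg_snd].
  have cf : continuous (@fst S T) by move=> ?; exact: cvg_fst.
  have cs : continuous (@snd S T) by move=> ?; exact: cvg_snd.
  apply: pair_continuous.
  + apply: (comp_continuous _ cL); apply: pair_continuous => //.
    by apply: pair_continuous; exact: comp_continuous cf.
  + apply: (comp_continuous _ cM); apply: pair_continuous => //.
    by apply: pair_continuous; exact: comp_continuous cs.
- by rewrite L0 M0.
- by rewrite L1 M1.
- by rewrite Lx Mx.
Qed.

Lemma cube_continuous n (T : topologicalType) (f : T -> cube R n) :
  (forall i, continuous (fun t => f t i)) -> continuous f.
Proof.
move=> cf t; apply/cvg_sup => i U [V [[B oB <-] /= Bt] BU].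
have := cf i t B (open_nbhs_nbhs (conj oB Bt)); rewrite nbhs_simpl /=.
by apply: (@filterS _ (nbhs t)) => y; exact: BU.
Qed.

(** The segments are taken coordinatewise, so that a segment between two points of a face stays in
    that face. *)
Lemma cube_segment n : exists L : unitI R * (cube R n * cube R n) -> cube R n,
  [/\ continuous L, forall x y, L (zero, (x, y)) = x,
      forall x y, L (one, (x, y)) = y &
      forall s x y i, x i = y i -> L (s, (x, y)) i = x i].
Proof.
have [L [cL L0 L1 Lx]] := unitI_equiconnected.
exists (fun z i => L (z.1, (z.2.1 i, z.2.2 i))); split.
- apply: cube_continuous => i.
  apply: (comp_continuous _ cL); apply: pair_continuous.
    by move=> ?; exact: cvg_fst.
  have c2 : continuous (fun z : unitI R * (cube R n * cube R n) => z.2).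
    by move=> ?; exact: cvg_snd.
  have ci := @cube_proj_continuous R n i.
  have cf : continuous (@fst (cube R n) (cube R n)) by move=> ?; exact: cvg_fst.
  have cs : continuous (@snd (cube R n) (cube R n)) by move=> ?; exact: cvg_snd.
  apply: pair_continuous.
    exact: (comp_continuous (comp_continuous c2 cf) ci).
  exact: (comp_continuous (comp_continuous c2 cs) ci).
- by move=> x y; apply/funext => i; rewrite L0.
- by move=> x y; apply/funext => i; rewrite L1.
- by move=> s x y i xy; rewrite /= -xy Lx.
Qed.

Lemma cube_equiconnected n : equiconnected R (cube R n).
Proof.
have [L [cL L0 L1 Lx]] := cube_segment n.
by exists L; split=> // s x; apply/funext => i; exact: Lx.
Qed.

(** The path that [L] assigns to the pair (x, x) is constant, so by compactness of the interval the
    one from [x] to [y] stays in [U] for [y] near [x]. *)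
Lemma equiconnected_near_path (T : topologicalType) (x : T) (U : set T) :
  equiconnected R T -> nbhs x U ->
  \forall y \near x, exists h : unitI R -> T,
    [/\ continuous h, h zero = x, h one = y & forall s, U (h s)].
Proof.
move=> [L [cL L0 L1 Lx]] nU.
have : \forall y \near x, forall s : unitI R, U (L (s, (x, y))).
  apply: (@compact_near _ _ (fun y s => U (L (s, (x, y)))) x (@unitI_compact R)).
  move=> s.
  have cg : continuous (fun z : T * unitI R => L (z.2, (x, z.1))).
    apply: (comp_continuous _ cL); apply: pair_continuous.
      by move=> ?; exact: cvg_snd.
    apply: pair_continuous; first exact: const_continuous.
    by move=> ?; exact: cvg_fst.
  by apply: (cg (x, s)); rewrite /= Lx.
apply: filterS => y Uy; exists (fun s => L (s, (x, y))); split => //.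
apply: (comp_continuous _ cL); apply: pair_continuous; first exact: id_continuous.
exact: const_continuous.
Qed.

End Equiconnected.

Lemma cos_sin_atan (R : realType) (c s : R) : 0 < c -> c ^+ 2 + s ^+ 2 = 1 ->
  cos (atan (s / c)) = c /\ sin (atan (s / c)) = s.
Proof.
move=> c0 cs1.
have cE : cos (atan (s / c)) = c.
  rewrite cos_atan (_ : 1 + _ = c^-1 ^+ 2).
    by rewrite sqrtr_sqr ger0_norm ?invr_ge0 ?ltW// invrK.
  rewrite expr_div_n (_ : s ^+ 2 = 1 - c ^+ 2); last by rewrite -cs1 addrC addKr.
  by field; rewrite gt_eqF.
split=> //; have := atanK (s / c); rewrite /tan cE => /(congr1 ( *%R^~ c)).
by rewrite !divfK ?gt_eqF.
Qed.

Lemma circle_angle (R : realType) (c s : R) : c ^+ 2 + s ^+ 2 = 1 ->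
  exists t, cos t = c /\ sin t = s.
Proof.
move=> cs1; have c1 : -1 <= c <= 1.
  by have := sqr_ge0 s; nra.
have sE : Num.sqrt (1 - c ^+ 2) = `|s| by rewrite -cs1 addrC addKr sqrtr_sqr.
have [s0|s0] := leP 0 s.
  by exists (acos c); rewrite acosK// sin_acos// sE ger0_norm.
exists (- acos c).
by rewrite cosN sinN acosK// sin_acos// sE ltr0_norm// opprK.
Qed.

Lemma atan_continuous (R : realType) : continuous (@atan R).
Proof. by move=> x; exact: continuous_atan. Qed.

Lemma divf_continuous (R : realType) (T : topologicalType) (u v : T -> R) :
  continuous u -> continuous v -> (forall t, v t != 0) ->
  continuous (fun t => u t / v t).
Proof.
move=> cu cv v0; apply: mulf_continuous => // t.
by apply: cvgV; [exact: v0 | exact: cv].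
Qed.

Section Lifting.
Variables (R : realType) (T : topologicalType).
Hypothesis cT : compact [set: T].

(* A circle-valued map has an angle as soon as it is everywhere less than a
   quarter turn away from a map which has one. *)
Lemma angle_near (c s th : T -> R) : continuous c -> continuous s ->
  continuous th -> (forall x, c x ^+ 2 + s x ^+ 2 = 1) ->
  (forall x, 0 < c x * cos (th x) + s x * sin (th x)) ->
  exists al : T -> R, [/\ continuous al,
    forall x, cos (th x + al x) = c x, forall x, sin (th x + al x) = s x &
    forall x, `|al x| < pi / 2].
Proof.
move=> cc cs cth cs1 pos.
(* The point (c', s') is (c, s) turned by the angle [- th]; it lies in the open right half-circle,
   where [atan] of the slope is a continuous angle. *)
pose c' x := c x * cos (th x) + s x * sin (th x).
pose s' x := s x * cos (th x) - c x * sin (th x).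
have cct := comp_continuous cth (@continuous_cos R).
have cst := comp_continuous cth (@continuous_sin R).
have cc' : continuous c' by apply: addf_continuous; exact: mulf_continuous.
have cs' : continuous s' by apply: subf_continuous; exact: mulf_continuous.
have cs1' x : c' x ^+ 2 + s' x ^+ 2 = 1.
  have := cos2Dsin2 (th x); have := cs1 x; rewrite /c' /s' => e1 e2.
  transitivity ((c x ^+ 2 + s x ^+ 2) * (cos (th x) ^+ 2 + sin (th x) ^+ 2)).
    by ring.
  by rewrite e1 e2 mulr1.
have aE x := cos_sin_atan (pos x) (cs1' x).
exists (fun x => atan (s' x / c' x)); split.
- apply: (comp_continuous _ (@atan_continuous R)); apply: divf_continuous => //.
  by move=> x; rewrite gt_eqF// pos.
- move=> x; have [ac as_] := aE x; rewrite cosD ac as_ /c' /s'.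
  transitivity (c x * (cos (th x) ^+ 2 + sin (th x) ^+ 2)); first by ring.
  by rewrite cos2Dsin2 mulr1.
- move=> x; have [ac as_] := aE x; rewrite sinD ac as_ /c' /s'.
  transitivity (s x * (cos (th x) ^+ 2 + sin (th x) ^+ 2)); first by ring.
  by rewrite cos2Dsin2 mulr1.
- by move=> x; rewrite ltr_norml atan_gtNpi2 atan_ltpi2.
Qed.

(** Contract [T] to [x0]. At time 0 the map is constant and has an angle; by compactness, maps at
    nearby times are less than a quarter turn apart, so having an angle is locally constant in
    time. *)
Lemma angle_lift (c s : T -> R) (x0 : T) : equiconnected R T ->
  continuous c -> continuous s -> (forall x, c x ^+ 2 + s x ^+ 2 = 1) ->
  exists th : T -> R, [/\ continuous th,
    forall x, cos (th x) = c x & forall x, sin (th x) = s x].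
Proof.
move=> [L [cL L0 L1 _]] cc cs cs1.
pose k a x := L (a, (x0, x)).
have ck : continuous (fun z : unitI R * T => k z.1 z.2).
  apply: (comp_continuous _ cL); apply: pair_continuous.
    by move=> ?; exact: cvg_fst.
  apply: pair_continuous; first exact: const_continuous.
  by move=> ?; exact: cvg_snd.
have cka a : continuous (k a).
  apply: (@comp_continuous _ _ _ (fun x => (a, x)) _ _ ck).
  by apply: pair_continuous; [exact: const_continuous | exact: id_continuous].
pose P a := exists th : T -> R, [/\ continuous th,
    forall x, cos (th x) = c (k a x) & forall x, sin (th x) = s (k a x)].
have stepP a b : (forall x, 0 < c (k a x) * c (k b x) + s (k a x) * s (k b x)) ->
    P a -> P b.
  move=> ab [th [cth thc ths]].
  have [||x|x|al [cal alc als _]] :=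
      @angle_near (c \o k b) (s \o k b) th _ _ cth.
  - exact: comp_continuous cc.
  - exact: comp_continuous cs.
  - exact: cs1.
  - by rewrite thc ths; have := ab x; congr (_ < _); rewrite /=; ring.
  by exists (fun x => th x + al x); split => //; exact: addf_continuous.
suff : P one by move=> [th thP]; exists th; move: thP; rewrite /k;
  case=> ? thc ths; split=> // x; rewrite ?thc ?ths L1.
apply: unitI_locally_constant => [a|]; last first.
  have [t [tc ts]] := circle_angle (cs1 x0).
  exists (fun=> t); split; first exact: const_continuous.
    by move=> x; rewrite /k L0.
  by move=> x; rewrite /k L0.
have near_pos : \forall b \near a,
    forall x, 0 < c (k a x) * c (k b x) + s (k a x) * s (k b x).
  apply: (compact_near cT
    (P := fun b x => 0 < c (k a x) * c (k b x) + s (k a x) * s (k b x))) => x.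
  have cg : continuous (fun z : unitI R * T => 
      c (k a z.2) * c (k z.1 z.2) + s (k a z.2) * s (k z.1 z.2)).
    have ca : continuous (fun z : unitI R * T => k a z.2).
      by apply: (comp_continuous _ (cka a)) => ?; exact: cvg_snd.
    by apply: addf_continuous; apply: mulf_continuous;
      apply: comp_continuous => //.
  have : nbhs (c (k a x) * c (k a x) + s (k a x) * s (k a x)) [set y : R | 0 < y].
    by apply: open_nbhs_nbhs; split; [exact: open_gt | rewrite /= -!expr2 cs1].
  by move/(cg (a, x)).
apply: filterS near_pos => b ab; split; apply: stepP => // x.
by rewrite mulrC [X in _ + X]mulrC.
Qed.

End Lifting.

Lemma insubd_continuous (T U : topologicalType) (A : set U) (a : A) (f : T -> U) :
  continuous f -> (forall t, A (f t)) ->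
  continuous (fun t => insubd a (f t) : A).
Proof.
move=> cf Af; apply/continuousP => _ [B oB <-].
move/continuousP: cf => /(_ B oB); congr open; apply/seteqP.
by split=> t /=; rewrite /set_val/= val_insubd ifT ?inE//; exact: Af.
Qed.

Lemma set_val_continuous (T U : topologicalType) (A : set U) (f : T -> A) :
  continuous f -> continuous (fun t => set_val (f t)).
Proof. by move=> cf; apply: (comp_continuous cf); exact: initial_continuous. Qed.

(** * The two spaces *)

Section Ambient.
Variable R : realType.

(** A name of its own for the product, to which the maximum metric is attached below. *)
Definition R4 : Type := (R * R * R * R)%type.

HB.instance Definition _ := PseudoMetric.copy R4 (R * R * R * R)%type.

Definition rad (q : R4) : R := q.1.1.1.
Definition abscissa (q : R4) : R := q.1.1.2.
Definition ordinate (q : R4) : R := q.1.2.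
Definition height (q : R4) : R := q.2.

Lemma rad_continuous : continuous rad.
Proof.
move=> q; apply: (@continuous_comp _ _ _ (fst \o fst) fst); last exact: cvg_fst.
by apply: continuous_comp; exact: cvg_fst.
Qed.

Lemma abscissa_continuous : continuous abscissa.
Proof.
move=> q; apply: (@continuous_comp _ _ _ (fst \o fst) snd); last exact: cvg_snd.
by apply: continuous_comp; exact: cvg_fst.
Qed.

Lemma ordinate_continuous : continuous ordinate.
Proof.
move=> q; apply: (@continuous_comp _ _ _ fst snd); first exact: cvg_fst.
exact: cvg_snd.
Qed.

Lemma height_continuous : continuous height.
Proof. by move=> q; exact: cvg_snd. Qed.

Let dist4 (q q' : R4) : R :=
  Num.max (Num.max (Num.max `|rad q - rad q'| `|abscissa q - abscissa q'|)
    `|ordinate q - ordinate q'|) `|height q - height q'|.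

Fact dist4_ge0 q q' : 0 <= dist4 q q'.
Proof. by rewrite /dist4 le_max normr_ge0 orbT. Qed.

Fact dist4_positivity q q' : dist4 q q' = 0 -> q = q'.
Proof.
move=> /eqP; rewrite eq_le dist4_ge0 andbT /dist4 !ge_max !normr_le0 !subr_eq0.
case: q => [[[a b] c] d]; case: q' => [[[a' b'] c'] d'].
rewrite /rad /abscissa /ordinate /height /=.
by move=> /andP[/andP[/andP[/eqP -> /eqP ->] /eqP ->] /eqP ->].
Qed.

Fact ballEdist4 (q : R4) d : ball q d = [set q' | dist4 q q' < d].
Proof.
apply/seteqP; split=> q' /=; rewrite /dist4 !gt_max.
  by move=> [[[/= ? ?] ?] ?]; apply/andP; split=> //; apply/andP; split=> //;
    apply/andP; split.
by move=> /andP[/andP[/andP[? ?] ?] ?].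
Qed.

HB.instance Definition _ := PseudoMetric_isMetric.Build R R4
  dist4_ge0 dist4_positivity ballEdist4.

Lemma R4_continuous (T : topologicalType) (a b c d : T -> R) :
  continuous a -> continuous b -> continuous c -> continuous d ->
  continuous (fun t => (a t, b t, c t, d t) : R4).
Proof. by move=> ca cb cc cd; do 3!apply: pair_continuous => //. Qed.

End Ambient.

Lemma squeeze_continuous (R : realType) (T : topologicalType) (f g : T -> R) (t : T) :
  {for t, continuous g} -> g t = 0 -> (forall s, `|f s| <= g s) ->
  {for t, continuous f}.
Proof.
move=> cg gt0 fg; have ft0 : f t = 0.
  by apply/eqP; rewrite -normr_le0 -gt0; exact: fg.
apply/cvgrPdist_lt => e e0; have /cvgrPdist_lt/(_ e e0) := cg.
apply: filterS => s; rewrite gt0 ft0 !sub0r !normrN.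
by apply: le_lt_trans; rewrite (le_trans (fg s))// ler_norm.
Qed.

Lemma continuous_near_eq (T U : topologicalType) (f g : T -> U) (t : T) :
  {for t, continuous g} -> (\forall s \near t, f s = g s) ->
  {for t, continuous f}.
Proof.
move=> cg fg V; rewrite (nbhs_singleton fg) => /cg; rewrite !nbhs_simpl /= => gV.
by apply: (@filterS2 _ (nbhs t) _ _ _ _ _ fg gV) => s /= ->.
Qed.

Section Spaces.
Variable R : realType.

(** The factor [r] flattens the circle at radius 0 to a segment, and [1 - x] damps the oscillation
    at the end [x = 1] of that segment, the base point. *)
Definition emb (r x y : R) : R4 R := (r, x, r * y, (1 - x) * sin r^-1).

(* [0^-1 = 0], so that [bigset] meets [rad = 0] in the segment of the points
   [(0, x, 0, 0)] with [-1 <= x <= 1]. *)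
Definition bigset : set (R4 R) :=
  [set q | exists r x y, [/\ 0 <= r, x ^+ 2 + y ^+ 2 = 1 & q = emb r x y]].

Definition smallset : set bigset :=
  [set q | 0 < rad (set_val q) \/ abscissa (set_val q) = 1].

Local Notation Y := (set_type bigset).
Local Notation X := (set_type smallset).

Fact base_subproof : emb 0 1 0 \in bigset.
Proof. by rewrite inE; exists 0, 1, 0; split; rewrite // expr1n expr0n addr0. Qed.

Definition base_big : Y := exist (fun q => q \in bigset) _ base_subproof.

Fact base_small_subproof : base_big \in smallset.
Proof. by rewrite inE; right. Qed.

Definition base : X := exist (fun q => q \in smallset) _ base_small_subproof.

(** Points outside the subset are sent to the base point, which makes [big] and [small] total. *)
Definition big (q : R4 R) : Y := insubd base_big q.
Definition small (q : Y) : X := insubd base q.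

Lemma bigK q : bigset q -> set_val (big q) = q.
Proof. by move=> Yq; apply: (insubdK base_big); rewrite inE. Qed.

Lemma smallK q : smallset q -> set_val (small q) = q.
Proof. by move=> Xq; apply: (insubdK base); rewrite inE. Qed.

Lemma bigP (q : Y) : bigset (set_val q).
Proof. exact: set_valP. Qed.

Lemma smallP (q : X) : smallset (set_val q).
Proof. exact: set_valP. Qed.

Lemma big_inj (q q' : Y) : set_val q = set_val q' -> q = q'.
Proof. exact: eq_sig_hprop. Qed.

Lemma small_inj (q q' : X) : set_val (set_val q) = set_val (set_val q') -> q = q'.
Proof. by move=> /big_inj; exact: eq_sig_hprop. Qed.

Lemma rad_ge0 (q : Y) : 0 <= rad (set_val q).
Proof. by have [r [x [y [? _ ->]]]] := bigP q. Qed.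

Lemma abscissa_itv (q : Y) : -1 <= abscissa (set_val q) <= 1.
Proof.
have [r [x [y [_ xy ->]]]] := bigP q; rewrite /abscissa /=.
by have := sqr_ge0 y; nra.
Qed.

Lemma heightE (q : Y) : height (set_val q) =
  (1 - abscissa (set_val q)) * sin (rad (set_val q))^-1.
Proof. by have [r [x [y [_ _ ->]]]] := bigP q. Qed.

Lemma ordinate0 (q : Y) : rad (set_val q) = 0 -> ordinate (set_val q) = 0.
Proof.
have [r [x [y [_ _ ->]]]] := bigP q.
by rewrite /rad /ordinate /= => ->; rewrite mul0r.
Qed.

Lemma big_ext (q q' : Y) : rad (set_val q) = rad (set_val q') ->
  abscissa (set_val q) = abscissa (set_val q') ->
  ordinate (set_val q) = ordinate (set_val q') -> q = q'.
Proof.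
move=> er ex ez; apply: big_inj; have := heightE q'; rewrite -er -ex -heightE.
move: er ex ez; rewrite /rad /abscissa /ordinate /height.
case: (set_val q) => [[[? ?] ?] ?]; case: (set_val q') => [[[? ?] ?] ?] /=.
by move=> -> -> -> ->.
Qed.

(* The junk value [0^-1 = 0] makes [sine] vanish where [rad] does. *)
Definition sine (q : R4 R) : R := ordinate q / rad q.

(** At abscissa 1 the sine must be 0, and so it is even at radius 0, where its value is the junk
    one. *)
Lemma circleE (q : X) : abscissa (set_val (set_val q)) ^+ 2 +
  sine (set_val (set_val q)) ^+ 2 = 1.
Proof.
have := smallP q => -[q0|q1].
  move: q0; have [r [x [y [_ xy ->]]]] := bigP (set_val q).
  rewrite /rad /abscissa /sine /ordinate /= => r0.
  by rewrite mulrAC divff ?gt_eqF// mul1r.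
rewrite q1; suff -> : sine (set_val (set_val q)) = 0.
  by rewrite expr1n expr0n addr0.
move: q1; have [r [x [y [_ xy ->]]]] := bigP (set_val q).
rewrite /rad /abscissa /sine /ordinate /= => x1.
have -> : y = 0.
  by apply/eqP; rewrite -sqrf_eq0; apply/eqP; move: xy; rewrite x1; lra.
by rewrite mulr0 mul0r.
Qed.

Lemma small_rad0 (q : X) : rad (set_val (set_val q)) = 0 ->
  abscissa (set_val (set_val q)) = 1.
Proof. by have := smallP q => -[/[swap] ->|//]; rewrite ltxx. Qed.

Section Coordinates.
Variables (T : topologicalType).

Lemma srad_continuous (f : T -> X) : continuous f ->
  continuous (fun t => rad (set_val (set_val (f t)))).
Proof.
move=> cf; apply: (comp_continuous _ (@rad_continuous R)).
by do 2!apply: set_val_continuous.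
Qed.

Lemma sabscissa_continuous (f : T -> X) : continuous f ->
  continuous (fun t => abscissa (set_val (set_val (f t)))).
Proof.
move=> cf; apply: (comp_continuous _ (@abscissa_continuous R)).
by do 2!apply: set_val_continuous.
Qed.

(** At radius 0 the quotient gives no information, but the sine is bounded by the square root of
    [1 - x ^+ 2], where the abscissa [x] tends to 1. *)
Lemma sine_continuous (f : T -> X) : continuous f ->
  continuous (fun t => sine (set_val (set_val (f t)))).
Proof.
move=> cf t; have cr := srad_continuous cf; have cx := sabscissa_continuous cf.
have co : continuous (fun t => ordinate (set_val (set_val (f t)))).
  apply: (comp_continuous _ (@ordinate_continuous R)).
  by do 2!apply: set_val_continuous.
have [r0|r0] := eqVneq (rad (set_val (set_val (f t)))) 0; last first.
  apply: (@continuousM _ _ (fun t => ordinate (set_val (set_val (f t))))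
    (fun t => (rad (set_val (set_val (f t))))^-1)); first exact: co.
  by apply: cvgV => //; exact: cr.
apply: (@squeeze_continuous _ _ _
  (fun t => Num.sqrt (1 - abscissa (set_val (set_val (f t))) ^+ 2))).
- apply: (comp_continuous _ (@sqrt_continuous R)).
  apply: subf_continuous; first exact: const_continuous.
  by apply: mulf_continuous.
- by rewrite small_rad0// expr1n subrr sqrtr0.
- move=> s; rewrite -(circleE (f s)) [X in X - _]addrC addrK sqrtr_sqr.
  exact: lexx.
Qed.

(** Where [r] vanishes, the oscillating coordinate is squeezed by [1 - x], which vanishes there
    too. *)
Lemma emb_continuous (r x y : T -> R) : continuous r -> continuous x ->
  continuous y -> (forall t, r t = 0 -> x t = 1) -> (forall t, x t <= 1) ->
  continuous (fun t => emb (r t) (x t) (y t)).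
Proof.
move=> cr cx cy r0x1 x1; apply: R4_continuous => //.
  exact: mulf_continuous.
move=> t; have [r0|r0] := eqVneq (r t) 0.
  apply: (@squeeze_continuous _ _ _ (fun t => 1 - x t)).
  - by apply: subf_continuous => //; exact: const_continuous.
  - by rewrite r0x1// subrr.
  - move=> s; rewrite normrM ger0_norm ?subr_ge0// ler_piMr ?subr_ge0//.
    by rewrite ler_norml sin_geN1 sin_le1.
apply: (@continuousM _ _ (fun t => 1 - x t) (fun t => sin (r t)^-1)).
  by apply: subf_continuous => //; exact: const_continuous.
apply: (@continuous_comp _ _ _ (fun t => (r t)^-1) sin); last exact: continuous_sin.
by apply: cvgV => //; exact: cr.
Qed.

End Coordinates.

(** * Polar coordinates on the smaller space *)

Definition angle (q : X) (a : R) : Prop :=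
  cos a = abscissa (set_val (set_val q)) /\ sin a = sine (set_val (set_val q)).

Definition polar (r a : R) : X := small (big (emb r (cos a) (sin a))).

(** At radius 0 the smaller space has only the base point, whose angles are the multiples of 2
    pi. *)
Definition polar_ok (r a : R) : Prop := 0 <= r /\ (r = 0 -> cos a = 1).

Lemma polarK r a : polar_ok r a ->
  set_val (set_val (polar r a)) = emb r (cos a) (sin a).
Proof.
move=> [r0 ra]; have Yq : bigset (emb r (cos a) (sin a)).
  by exists r, (cos a), (sin a); split; rewrite ?cos2Dsin2.
rewrite smallK ?bigK// /smallset /= bigK//.
by move: r0; rewrite le_eqVlt => /predU1P[/esym/ra|]; [right | left].
Qed.

Lemma angle_polar_ok q a : angle q a -> polar_ok (rad (set_val (set_val q))) a.
Proof. by move=> [qa _]; split; [exact: rad_ge0 | rewrite qa; exact: small_rad0]. Qed.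

Lemma polar_angle q a : angle q a -> polar (rad (set_val (set_val q))) a = q.
Proof.
move=> qa; have ok := angle_polar_ok qa; case: qa => qc qs.
apply/eq_sig_hprop => //; apply: big_ext; rewrite polarK//.
rewrite /ordinate /= qs /sine.
have [r0|r0] := eqVneq (rad (set_val (set_val q))) 0.
  by rewrite r0 mul0r; apply/esym/ordinate0.
by rewrite mulrC divfK.
Qed.

Lemma polar_ok_angle r a : polar_ok r a -> angle (polar r a) a.
Proof.
move=> ok; rewrite /angle polarK//; split=> //; rewrite /sine /ordinate /rad /=.
have [r0|r0] := eqVneq r 0; last by rewrite mulrAC divff// mul1r.
rewrite r0 mul0r; have := cos2Dsin2 a; rewrite ok.2// expr1n => e.
by rewrite mul0r; apply/eqP; rewrite -sqrf_eq0; apply/eqP; lra.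
Qed.

Lemma angle_ex q : exists a, angle q a.
Proof. exact: circle_angle (circleE q). Qed.

Lemma polar_continuous (T : topologicalType) (r a : T -> R) :
  continuous r -> continuous a -> (forall t, polar_ok (r t) (a t)) ->
  continuous (fun t => polar (r t) (a t)).
Proof.
move=> cr ca ok; have Yq t : bigset (emb (r t) (cos (a t)) (sin (a t))).
  by exists (r t), (cos (a t)), (sin (a t)); split; rewrite ?cos2Dsin2; have [] := ok t.
apply: insubd_continuous => [|t].
  apply: insubd_continuous => //; apply: emb_continuous => //.
  - exact: (comp_continuous ca (@continuous_cos R)).
  - exact: (comp_continuous ca (@continuous_sin R)).
  - by move=> t; have [_] := ok t.
rewrite /smallset /= bigK//; have [] := ok t.
rewrite le_eqVlt => /predU1P[/esym r0 h|r0 _]; [right | by left].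
exact: h.
Qed.

Lemma angle_lift_small (T : topologicalType) (t0 : T) (f : T -> X) :
  compact [set: T] -> equiconnected R T -> continuous f ->
  exists a, continuous a /\ forall t, angle (f t) (a t).
Proof.
move=> cT eT cf.
have [||t|a [ca ac as_]] := @angle_lift R T cT
  (fun t => abscissa (set_val (set_val (f t))))
  (fun t => sine (set_val (set_val (f t)))) t0 eT.
- exact: sabscissa_continuous.
- exact: sine_continuous.
- exact: circleE.
by exists a.
Qed.

(* The term [s * (1 - s) * _] keeps the straight-line homotopy of polar
   coordinates away from [rad = 0], where only the angles in [2 pi Z] are
   allowed. *)
Lemma angle_joined (D : cuboid R) (q : X) (f g : loop_space D q) (a b : D -> R) :
  continuous a -> continuous b ->
  (forall x, angle (loop_fun f x) (a x)) -> (forall x, angle (loop_fun g x) (b x)) ->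
  (forall x, bd D x -> a x = b x) -> path_joined R f g.
Proof.
move=> ca cb fa gb ab.
pose rf x := rad (set_val (set_val (loop_fun f x))).
pose rg x := rad (set_val (set_val (loop_fun g x))).
have crf : continuous rf by apply: srad_continuous; exact: loop_continuous.
have crg : continuous rg by apply: srad_continuous; exact: loop_continuous.
(* The weight vanishes on the boundary, so the added term does not move the base point. *)
pose w x := `|rf x - rg x| + `|a x - b x|.
pose r (z : unitI R * D) := (1 - ival z.1) * rf z.2 + ival z.1 * rg z.2 +
  ival z.1 * (1 - ival z.1) * w z.2.
pose c (z : unitI R * D) := (1 - ival z.1) * a z.2 + ival z.1 * b z.2.
have c1 : continuous (fun z : unitI R * D => ival z.1).
  by apply: (comp_continuous _ (@ival_continuous R)) => ?; exact: cvg_fst.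
have c1' : continuous (fun z : unitI R * D => 1 - ival z.1).
  by apply: subf_continuous => //; exact: const_continuous.
have c2 (h : D -> R) : continuous h -> continuous (fun z : unitI R * D => h z.2).
  by move=> ch; apply: comp_continuous ch => ?; exact: cvg_snd.
have cw : continuous w.
  by apply: addf_continuous; apply: normf_continuous; apply: subf_continuous.
have cr : continuous r.
  do 2?apply: addf_continuous; apply: mulf_continuous => //; try exact: c2.
  exact: mulf_continuous.
have cc : continuous c.
  by apply: addf_continuous; apply: mulf_continuous => //; exact: c2.
have ok z : polar_ok (r z) (c z).
  case: z => s x; have := ival_itv s; rewrite /r /c /=.
  set u := ival s => /andP[u0 u1].
  have rf0 : 0 <= rf x by exact: rad_ge0.
  have rg0 : 0 <= rg x by exact: rad_ge0.
  have w0 : 0 <= w x by rewrite addr_ge0.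
  have u1' : 0 <= 1 - u by rewrite subr_ge0.
  have h1 : 0 <= (1 - u) * rf x by rewrite mulr_ge0.
  have h2 : 0 <= u * rg x by rewrite mulr_ge0.
  have h3 : 0 <= u * (1 - u) * w x by rewrite mulr_ge0// mulr_ge0.
  split; first by rewrite !addr_ge0.
  move=> e.
  (* A zero radius makes all three nonnegative terms vanish. Strictly between times 0 and 1 this
     forces [w x = 0], so both angles agree and the common one is admissible. *)
  have {}h1 : (1 - u) * rf x = 0 by lra.
  have {}h2 : u * rg x = 0 by lra.
  have {}h3 : u * (1 - u) * w x = 0 by lra.
  have okf := (angle_polar_ok (fa x)).2; have okg := (angle_polar_ok (gb x)).2.
  have [ue0|un0] := eqVneq u 0.
    rewrite ue0 subr0 mul1r mul0r addr0; apply: okf.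
    by move: h1; rewrite ue0 subr0 mul1r.
  have [ue1|un1] := eqVneq u 1.
    rewrite ue1 subrr mul1r mul0r add0r; apply: okg.
    by move: h2; rewrite ue1 mul1r.
  have {}h1 : rf x = 0.
    by move/eqP: h1; rewrite mulf_eq0 subr_eq0 eq_sym (negbTE un1) => /eqP.
  have {}h3 : w x = 0.
    move/eqP: h3; rewrite !mulf_eq0 subr_eq0 (negbTE un0) eq_sym.
    by rewrite (negbTE un1) => /eqP.
  have -> : b x = a x.
    apply/eqP; rewrite eq_sym -subr_eq0 -normr_le0.
    by have := normr_ge0 (rf x - rg x); move: h3; rewrite /w; lra.
  by rewrite -mulrDl subrK mul1r; exact: okf.
apply/path_joined_homotopyP; exists (fun z => polar (r z) (c z)); split.
- exact: polar_continuous.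
- move=> x; rewrite -(polar_angle (fa x)) /r /c /= ival_zero.
  by rewrite subr0 !mul1r !mul0r !addr0.
- move=> x; rewrite -(polar_angle (gb x)) /r /c /= ival_one.
  by rewrite subrr !mul1r !mul0r ?mulr0 !add0r ?addr0.
- move=> s x bx; have ax : angle q (a x) by rewrite -(loop_bd f bx).
  rewrite -[RHS](polar_angle ax) /r /c /w /= -(ab _ bx) /rf /rg.
  rewrite !(loop_bd _ bx) !subrr normr0 addr0 mulr0 addr0.
  by rewrite -!mulrDl !subrK !mul1r.
Qed.

End Spaces.

Lemma near_lt (R : realType) (T : topologicalType) (f : T -> R) (t : T) (a : R) :
  {for t, continuous f} -> f t < a -> \forall s \near t, f s < a.
Proof.
move=> cf fa; have /cf : nbhs (f t) [set y : R | y < a].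
  by apply: open_nbhs_nbhs; split; first exact: open_lt.
by rewrite nbhs_simpl.
Qed.

Lemma near_gt (R : realType) (T : topologicalType) (f : T -> R) (t : T) (a : R) :
  {for t, continuous f} -> a < f t -> \forall s \near t, a < f s.
Proof.
move=> cf fa; have /cf : nbhs (f t) [set y : R | a < y].
  by apply: open_nbhs_nbhs; split; first exact: open_gt.
by rewrite nbhs_simpl.
Qed.

(** * The inclusion is a weak equivalence *)

Section Crushing.
Variable R : realType.

Local Notation Y := (set_type (@bigset R)).
Local Notation X := (set_type (@smallset R)).

Lemma segment_big (x : R) : -1 <= x <= 1 -> bigset (0, x, 0, 0).
Proof.
move=> x1; exists 0, x, (Num.sqrt (1 - x ^+ 2)); split=> //.
  by rewrite sqr_sqrtr; [lra | nra].
by rewrite /emb mul0r invr0 sin0 mulr0.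
Qed.

(** On the segment the distance to the base point is multiplied by [1 - s]; all points of positive
    radius stay fixed. *)
Definition crush (s : unitI R) (q : Y) : Y := if 0 < rad (set_val q) then q
  else big (0, 1 - (1 - ival s) * (1 - abscissa (set_val q)), 0, 0).

Lemma crushE s q : set_val (crush s q) = (rad (set_val q),
  (if 0 < rad (set_val q) then abscissa (set_val q)
   else 1 - (1 - ival s) * (1 - abscissa (set_val q))),
  ordinate (set_val q), height (set_val q)).
Proof.
rewrite /crush; case: ifPn => [r0|].
  by rewrite /rad /abscissa /ordinate /height; case: (set_val q) => [[[]]].
rewrite -leNgt => r0; have {}r0 : rad (set_val q) = 0.
  by apply/eqP; rewrite eq_le r0 rad_ge0.
rewrite bigK; first by rewrite heightE ordinate0// r0 invr0 sin0 mulr0.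
apply: segment_big; have := ival_itv s; have := abscissa_itv q.
by nra.
Qed.

Lemma crush0 q : crush zero q = q.
Proof.
apply: big_ext; rewrite crushE// /abscissa /= ival_zero.
by case: ifP => // _; rewrite subr0 mul1r opprB addrC subrK.
Qed.

Lemma crush_small s (q : X) : crush s (set_val q) = set_val q.
Proof.
apply: big_ext; rewrite crushE// /abscissa /=; case: ifPn => //.
rewrite -leNgt => r0; have {}r0 : rad (set_val (set_val q)) = 0.
  by apply/eqP; rewrite eq_le r0 rad_ge0.
by rewrite -/(abscissa _) small_rad0// subrr mulr0 subr0.
Qed.

Definition collapse (q : Y) : X := small (crush one q).

Lemma collapseK (q : Y) : set_val (collapse q) = crush one q.
Proof.
apply: smallK; rewrite /smallset /= crushE /rad /abscissa /= ival_one subrr mul0r subr0.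
by case: ifP; [left | right].
Qed.

Lemma collapse_small (q : X) : collapse (set_val q) = q.
Proof. by apply: small_inj; rewrite collapseK crush_small. Qed.

Section Continuity.
Variables (T : topologicalType) (F : T -> Y).
Hypotheses (eT : equiconnected R T) (cF : continuous F).

Let cr : continuous (fun t => rad (set_val (F t))).
Proof. exact: (comp_continuous (set_val_continuous cF) (@rad_continuous R)). Qed.

Let cx : continuous (fun t => abscissa (set_val (F t))).
Proof. exact: (comp_continuous (set_val_continuous cF) (@abscissa_continuous R)). Qed.

Let ch : continuous (fun t => height (set_val (F t))).
Proof. exact: (comp_continuous (set_val_continuous cF) (@height_continuous R)). Qed.

(* Along a path leaving the segment [rad = 0] the radius takes values at which
   [sin (rad^-1) = 1], so that the height oscillates. *)
Lemma rad0_near (t : T) : rad (set_val (F t)) = 0 -> abscissa (set_val (F t)) < 1 ->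
  \forall s \near t, rad (set_val (F s)) = 0.
Proof.
move=> r0; set x0 := abscissa _ => x1.
have h0 : height (set_val (F t)) = 0 by rewrite heightE r0 invr0 sin0 mulr0.
(* The two bounds are incompatible with [sin (rad^-1) = 1]: there the height equals 1 minus the
   abscissa, which exceeds [(1 - x0) / 2]. *)
have nx : \forall s \near t, abscissa (set_val (F s)) < (1 + x0) / 2.
  by apply: (near_lt (@cx _)); rewrite -/x0; lra.
have nh : \forall s \near t, height (set_val (F s)) < (1 - x0) / 2.
  by apply: (near_lt (@ch _)); rewrite h0; lra.
apply: filterS (equiconnected_near_path eT (filterI nx nh)) => s [k [ck k0 k1 kU]].
apply/eqP; rewrite eq_le rad_ge0 andbT leNgt; apply/negP => rs0.
(* This makes [v^-1] smaller than the radius at [s], so that the path from [t] to [s] passes through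
   the radius [v^-1], and [sin v = 1]. *)
pose n := (Num.truncn (rad (set_val (F s)))^-1).+1.
pose v : R := pi / 2 + pi *+ 2 *+ n.
have pi2 : 2 <= pi :> R := pi_ge2 R.
have nv : n%:R <= v.
  rewrite /v -mulrnA -[pi *+ _]mulr_natr natrM.
  by have : 0 <= n%:R :> R := ler0n _ _; nra.
have rn : (rad (set_val (F s)))^-1 < v.
  by apply: lt_le_trans nv; exact: truncnS_gt.
have v0 : 0 < v by apply: lt_trans rn; rewrite invr_gt0.
have [||u ru] := @unitI_IVT R (fun u => rad (set_val (F (k u)))) v^-1.
- exact: (comp_continuous ck cr).
- rewrite k0 k1 r0 (min_idPl (ltW rs0)) (max_idPr (ltW rs0)) invr_ge0 (ltW v0) /=.
  by rewrite -[leRHS]invrK lef_pV2 ?posrE ?invr_gt0// ltW.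
have [xu hu] := kU u; move: hu; rewrite heightE ru invrK.
have -> : sin v = 1.
  by rewrite /v (periodicn (@sinD2pi R)) sin_pihalf.
by move: xu => /=; lra.
Qed.

(** Only the abscissa is at issue. At positive radius it is locally unchanged; inside the segment
    [rad0_near] keeps all nearby values in the segment; at the base point its distance to 1 is
    squeezed by that of the original abscissa. *)
Lemma crush_continuous : continuous (fun z : unitI R * T => crush z.1 (F z.2)).
Proof.
suff cv : continuous (fun z : unitI R * T => set_val (crush z.1 (F z.2))).
  apply/continuousP => _ [B oB <-].
  by move/continuousP: cv => /(_ B oB).
have c2 : continuous (fun z : unitI R * T => z.2) by move=> ?; exact: cvg_snd.
have c1 : continuous (fun z : unitI R * T => ival z.1).
  by apply: (comp_continuous _ (@ival_continuous R)) => ?; exact: cvg_fst.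
have co := comp_continuous (set_val_continuous cF) (@ordinate_continuous R).
have cr2 := comp_continuous c2 cr; have cx2 := comp_continuous c2 cx.
rewrite (_ : (fun z => _) = (fun z : unitI R * T => (rad (set_val (F z.2)),
  (if 0 < rad (set_val (F z.2)) then abscissa (set_val (F z.2))
   else 1 - (1 - ival z.1) * (1 - abscissa (set_val (F z.2)))),
  ordinate (set_val (F z.2)), height (set_val (F z.2))) : R4 R)); last first.
  by apply/funext => z; exact: crushE.
apply: R4_continuous => //; last 2 first.
- exact: (comp_continuous c2 co).
- exact: (comp_continuous c2 ch).
move=> z; have cl : continuous (fun z : unitI R * T =>
    1 - (1 - ival z.1) * (1 - abscissa (set_val (F z.2)))).
  apply: subf_continuous; first exact: const_continuous.
  by apply: mulf_continuous; apply: subf_continuous => //; exact: const_continuous.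
have := rad_ge0 (F z.2); rewrite le_eqVlt => /predU1P[/esym r0|r0]; last first.
  apply: (continuous_near_eq (cx2 z)).
  by apply: filterS (near_gt (cr2 z) r0) => y ->.
have /andP[_] := abscissa_itv (F z.2); rewrite le_eqVlt => /predU1P[x1|x1]; last first.
  apply: (continuous_near_eq (cl z)).
  have : \forall y \near z, rad (set_val (F y.2)) = 0.
    exact: (c2 z _ (rad0_near r0 x1)).
  by apply: filterS => y ->; rewrite ltxx.
pose f z := 1 - (if 0 < rad (set_val (F z.2)) then abscissa (set_val (F z.2))
   else 1 - (1 - ival z.1) * (1 - abscissa (set_val (F z.2)))).
have cf : {for z, continuous f}.
  apply: (@squeeze_continuous _ _ _ (fun z => 1 - abscissa (set_val (F z.2)))).
  - by apply: subf_continuous => //; exact: const_continuous.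
  - by rewrite x1 subrr.
  - move=> [s t]; rewrite /f /=; have := ival_itv s; have := abscissa_itv (F t).
    set x := abscissa _; set u := ival s => x_itv u_itv.
    by rewrite ler_norml; case: ifP => _; nra.
rewrite (_ : (fun z => _) = (fun z => 1 - f z)).
  by apply: (@continuousB _ R^o) => //; exact: cst_continuous.
by apply/funext => y; rewrite /f subKr.
Qed.

Lemma collapse_continuous : continuous (fun t => collapse (F t)).
Proof.
apply: insubd_continuous => [|t]; last by rewrite -collapseK; exact: smallP.
apply: (@comp_continuous _ _ _ (fun t => (one, t)) _ _ crush_continuous).
by apply: pair_continuous; [exact: const_continuous | exact: id_continuous].
Qed.

End Continuity.
End Crushing.

Lemma clamp_le0 (R : realType) (r : R) : r <= 0 -> clamp r = zero.
Proof.
move=> r0; apply: ival_inj; rewrite ival_zero ival_clamp; apply/max_idPl.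
by rewrite ge_min r0 orbT.
Qed.

Lemma clamp_ge1 (R : realType) (r : R) : 1 <= r -> clamp r = one.
Proof.
by move=> r1; apply: ival_inj; rewrite ival_one ival_clamp (min_idPl r1) (max_idPr _).
Qed.

Lemma cube_bd_zero (R : realType) n : cube_bd ((fun=> zero) : cube R n).
Proof. by exists ord0; left. Qed.

Section InclusionIsomorphism.
Variables (R : realType) (D : cuboid R) (q : set_type (@smallset R)).
Hypothesis eD : equiconnected R D.

(** The inverse is induced by [collapse]. It respects homotopies because their domain is again
    equiconnected, and [crush] joins a loop of the larger space to its collapsed version. *)
Lemma inclusion_isomorphism :
  group_isomorphism (@classes_map R D _ _ (inclusion (@smallset R)) q).
Proof.
pose q' := inclusion (@smallset R) q.
have cl (f : loop_space D q') : continuous (fun x => collapse (loop_fun f x)).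
  by apply: collapse_continuous => //; exact: loop_continuous.
have bl (f : loop_space D q') x : bd D x -> collapse (loop_fun f x) = q.
  by move=> bx; rewrite loop_bd//; exact: collapse_small.
pose c f := mk_loop (cl f) (bl f).
have cJ f g : path_joined R f g -> path_joined R (c f) (c g).
  move=> /path_joined_homotopyP[H [cH H0 H1 Hq]].
  apply/path_joined_homotopyP; exists (fun z => collapse (H z)); split.
  - by apply: collapse_continuous => //; apply: prod_equiconnected => //;
      exact: unitI_equiconnected.
  - by move=> x; rewrite H0.
  - by move=> x; rewrite H1.
  - by move=> s x bx; rewrite Hq//; exact: collapse_small.
split; last exact: classes_map_is_multiplicative.
exists (fun a => loop_class (c (loop_repr a))) => a.
  rewrite -{1}[a]loop_reprK classes_mapE -[RHS]loop_reprK.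
  apply/loop_classP; apply: path_joined_trans (cJ _ _ (loop_repr_joined _)) _.
  set f := loop_repr a; rewrite (_ : c _ = f); first exact: path_joined_refl.
  by apply: loop_inj => x; exact: collapse_small.
rewrite classes_mapE -[RHS]loop_reprK; apply/loop_classP/path_joined_sym.
set f := loop_repr a; apply/path_joined_homotopyP.
exists (fun z => crush z.1 (loop_fun f z.2)); split.
- by apply: crush_continuous => //; exact: loop_continuous.
- by move=> x; rewrite crush0.
- by move=> x; rewrite -collapseK.
- by move=> s x bx; rewrite loop_bd//; exact: crush_small.
Qed.

End InclusionIsomorphism.

(** * Asphericity of both spaces *)

Section Aspherical.
Variables (R : realType).
Local Notation Y := (set_type (@bigset R)).
Local Notation X := (set_type (@smallset R)).

Lemma angle_cosB (q : X) (a b : R) : angle q a -> angle q b -> cos (a - b) = 1.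
Proof. by move=> [ac as_] [bc bs]; rewrite cosB ac as_ bc bs -!expr2 circleE. Qed.

(** The cube has [n.+2] coordinates, so its boundary is connected: along a segment in a face [a] can
    only change by a multiple of 2 pi, hence not at all, and two such segments lead to the corner
    0. *)
Lemma cube_bd_const n (a : cube R n.+1 -> R) : continuous a ->
  (forall x y, cube_bd x -> cube_bd y -> cos (a x - a y) = 1) ->
  forall x y, cube_bd x -> cube_bd y -> a x = a y.
Proof.
move=> ca a1; have [L [cL L0 L1 Lx]] := cube_segment R n.+1.
have segment x y i : x i = y i -> (x i = zero \/ x i = one) -> a x = a y.
  move=> xy xi; have cs : continuous (fun s => L (s, (x, y))).
    apply: (comp_continuous _ cL); apply: pair_continuous; first exact: id_continuous.
    exact: const_continuous.
  have := @cos_eq1_const R (fun s => a (L (s, (x, y))) - a x).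
  rewrite L0 L1 => h; apply/eqP; rewrite eq_sym -subr_eq0 -h ?subrr//.
    by apply: subf_continuous; [exact: comp_continuous ca | exact: const_continuous].
  by move=> s; apply: a1; exists i => //; rewrite Lx.
suff toz x : cube_bd x -> a x = a (fun=> zero) by move=> x y /toz -> /toz ->.
move=> [i xi]; have [j ji] : exists j : 'I_n.+2, j != i.
  exists (if i == ord0 then ord_max else ord0).
  by case: (eqVneq i ord0) => [->|]; rewrite // eq_sym.
(* The intermediate point shares the face of index [i] with [x] and a face of index [j] with the
   corner. *)
rewrite (@segment x (fun k => if k == j then zero else x k) i)
  ?[i == j]eq_sym ?(negbTE ji)//.
by apply: (@segment _ _ j); rewrite eqxx//; left.
Qed.

(** An angle of [f] is constant on the boundary, so [angle_joined] applies with that constant as the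
    angle of the constant map. *)
Lemma small_null n (q : X) (f : loop_space (cube_cuboid R n.+1) q) :
  path_joined R f loop_cst.
Proof.
have [a [ca fa]] := @angle_lift_small R (cube R n.+1) (fun=> zero) _
  (@cuboid_compact _ (cube_cuboid R n.+1)) (cube_equiconnected R n.+1)
  (@loop_continuous _ _ _ _ f).
have b0 := cube_bd_zero R n.+1.
have bq x : cube_bd x -> angle q (a x).
  by move=> bx; rewrite -(loop_bd f bx); exact: fa.
apply: (@angle_joined R _ q f loop_cst a (fun=> a (fun=> zero))) => //.
- exact: const_continuous.
- by move=> x; exact: bq.
- move=> x bx; apply: (cube_bd_const ca) => // y z by_ bz.
  by apply: (@angle_cosB q); exact: bq.
Qed.

(* A homotopy moving the boundary along a path [g] is turned into one fixing
   the boundary by letting a collar of the cube follow [g]. *)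
Lemma cube_base_change n (Z : uniformType) (p q : Z)
    (f : loop_space (cube_cuboid R n) p) (G : unitI R * cube R n -> Z)
    (g : unitI R -> Z) : continuous G -> continuous g ->
  (forall x, G (zero, x) = loop_fun f x) -> (forall x, G (one, x) = q) ->
  (forall s x, cube_bd x -> G (s, x) = g s) -> path_joined R f loop_cst.
Proof.
move=> cG cg G0 G1 Gg.
(* The function [m] is 0 on the boundary and 1 on the central cube of points with coordinates in
   [1/4, 3/4]. The map [rho] dilates about the centre by the factor [1 + s], with clamping; at
   [s = 1] it spreads the central cube over the whole cube and sends the collar to the boundary. *)
pose mu (t : R) : R := Num.min 1 (4 * Num.min t (1 - t)).
pose m (x : cube R n) : R := \prod_i mu (ival (x i)).
pose rho (z : unitI R * cube R n) : cube R n :=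
  fun i => clamp ((1 + ival z.1) * ival (z.2 i) - ival z.1 / 2).
have cmu : continuous mu.
  apply: minf_continuous; first exact: const_continuous.
  apply: mulf_continuous; first exact: const_continuous.
  apply: minf_continuous; first exact: id_continuous.
  by apply: subf_continuous; [exact: const_continuous | exact: id_continuous].
have mu01 t : 0 <= t <= 1 -> 0 <= mu t <= 1.
  move=> t01; rewrite /mu ge_min lexx andbT le_min ler01 /=.
  by rewrite mulr_ge0// le_min; lra.
have m01 x : 0 <= m x <= 1.
  apply: (big_ind (fun r => 0 <= r <= 1)) => [|r s r01 s01|i _].
  - by rewrite ler01 lexx.
  - by have := r01; have := s01; nra.
  - exact/mu01/ival_itv.
have ci i := @cube_proj_continuous R n i.
have cm : continuous m.
  rewrite /m; elim: (index_enum _) => [|i s IHs].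
    under [X in continuous X]eq_fun do rewrite big_nil.
    exact: const_continuous.
  under [X in continuous X]eq_fun do rewrite big_cons.
  apply: mulf_continuous => //; apply: (comp_continuous _ cmu).
  exact: (comp_continuous (ci i) (@ival_continuous R)).
have m_bd x : cube_bd x -> m x = 0.
  move=> [i xi]; rewrite /m (bigD1 i)//= (_ : mu _ = 0) ?mul0r//.
  by rewrite /mu /Order.min; case: xi => ->; rewrite ?ival_zero ?ival_one
    ?subr0 ?subrr ?ltr01 ?ltr10 mulr0 ltr10.
have rho_bd s x : cube_bd x -> cube_bd (rho (s, x)).
  move=> [i xi]; exists i; rewrite /rho /=; have := ival_itv s.
  case: xi => ->; rewrite ?ival_zero ?ival_one => s01.
    by left; apply: clamp_le0; lra.
  by right; apply: clamp_ge1; lra.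
have rho1 x : m x < 1 -> cube_bd (rho (one, x)).
  move=> mx; have [i mi] : exists i, mu (ival (x i)) < 1.
    apply: contrapT => /forallNP h; move: mx; rewrite /m big1 ?ltxx// => i _.
    apply/eqP; rewrite eq_le; have /andP[_ ->] := mu01 _ (ival_itv (x i)).
    by rewrite leNgt; exact/negP.
  exists i; rewrite /rho /= ival_one; move: mi.
  rewrite /mu gt_min ltxx /= -ltr_pdivlMl// gt_min => /orP[] h.
    by left; apply: clamp_le0; lra.
  by right; apply: clamp_ge1; lra.
have c1 : continuous (fun z : unitI R * cube R n => ival z.1).
  by apply: (comp_continuous _ (@ival_continuous R)) => ?; exact: cvg_fst.
have c2 : continuous (fun z : unitI R * cube R n => z.2) by move=> ?; exact: cvg_snd.
have crho : continuous rho.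
  apply: cube_continuous => i; apply: (comp_continuous _ (@clamp_continuous R)).
  apply: subf_continuous; last first.
    by apply: mulf_continuous => //; exact: const_continuous.
  apply: mulf_continuous; first by apply: addf_continuous => //; exact: const_continuous.
  exact: (comp_continuous (comp_continuous c2 (ci i)) (@ival_continuous R)).
have cgm : continuous (fun x => g (clamp (m x))).
  exact: (comp_continuous (comp_continuous cm (@clamp_continuous R)) cg).
have b0 := cube_bd_zero R n.
have g0 : g zero = p by rewrite -(Gg _ _ b0) G0 loop_bd.
have gm_bd x : cube_bd x -> g (clamp (m x)) = p by move=> bx; rewrite m_bd// g0.
pose gm : loop_space (cube_cuboid R n) p :=
  @mk_loop R (cube_cuboid R n) Z p _ cgm gm_bd.
(* First [f] is deformed into [gm], which depends on [m x] only: on the collar it follows [g], and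
   on the central cube it equals [q = g one]. Then [gm] is shrunk by scaling [m] to 0. *)
apply: (@path_joined_trans _ _ gm); apply/path_joined_homotopyP.
  exists (fun z => G (clamp (ival z.1 * m z.2), rho z)); split.
  - apply: (comp_continuous _ cG); apply: pair_continuous => //.
    apply: (comp_continuous _ (@clamp_continuous R)); apply: mulf_continuous => //.
    exact: (comp_continuous c2 cm).
  - move=> x /=; rewrite ival_zero mul0r G0; congr loop_fun.
    by apply/funext => i; rewrite /rho /= ival_zero addr0 mul1r mul0r subr0 ivalK.
  - move=> x /=; rewrite ival_one mul1r.
    have [m1|m1] := leP 1 (m x); last by rewrite Gg//; exact: rho1.
    by rewrite clamp_ge1// G1 -(G1 (fun=> zero)) Gg//
      -[RHS]/(g (clamp (m x))) clamp_ge1.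
  - by move=> s x bx /=; rewrite m_bd// mulr0 G0 loop_bd//; exact: rho_bd.
exists (fun z => g (clamp ((1 - ival z.1) * m z.2))); split.
- apply: (comp_continuous _ cg); apply: (comp_continuous _ (@clamp_continuous R)).
  apply: mulf_continuous; last exact: (comp_continuous c2 cm).
  by apply: subf_continuous => //; exact: const_continuous.
- by move=> x /=; rewrite ival_zero subr0 mul1r.
- by move=> x /=; rewrite ival_one subrr mul0r.
- by move=> s x bx /=; rewrite m_bd// mulr0.
Qed.

(** Crush [f] into the smaller space, then contract it there. If [q] lies on the segment, crushing
    moves the base point, which [cube_base_change] repairs. *)
Lemma big_null n (q : Y) (f : loop_space (cube_cuboid R n.+1) q) :
  path_joined R f loop_cst.
Proof.
have eD : equiconnected R (cube_cuboid R n.+1) := cube_equiconnected R n.+1.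
have cf := @loop_continuous _ _ _ _ f.
have bf x : bd (cube_cuboid R n.+1) x -> collapse (loop_fun f x) = collapse q.
  by move=> bx; rewrite loop_bd.
have /path_joined_homotopyP[H [cH H0 H1 Hq]] :=
  small_null (mk_loop (collapse_continuous eD cf) bf).
have ccr := crush_continuous eD cf.
have c1 : continuous (fun z : unitI R * cube R n.+1 => ival z.1).
  by apply: (comp_continuous _ (@ival_continuous R)) => ?; exact: cvg_fst.
have c2 : continuous (fun z : unitI R * cube R n.+1 => z.2) by move=> ?; exact: cvg_snd.
have cl : continuous (fun z : unitI R * cube R n.+1 => 2 * ival z.1).
  by apply: mulf_continuous => //; exact: const_continuous.
pose G (z : unitI R * cube R n.+1) : Y := if ival z.1 <= 2^-1
  then crush (clamp (2 * ival z.1)) (loop_fun f z.2)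
  else set_val (H (clamp (2 * ival z.1 - 1), z.2)).
have cG : continuous G.
  apply: paste_continuous => //.
  - apply: (@comp_continuous _ _ _ (fun z : unitI R * cube R n.+1 =>
      (clamp (2 * ival z.1), z.2)) _ _ ccr).
    by apply: pair_continuous => //; exact: (comp_continuous cl (@clamp_continuous R)).
  - apply: set_val_continuous; apply: (comp_continuous _ cH).
    apply: pair_continuous => //; apply: (comp_continuous _ (@clamp_continuous R)).
    by apply: subf_continuous => //; exact: const_continuous.
  - by move=> z ->; rewrite divff// subrr H0 -collapseK.
have b0 := cube_bd_zero R n.+1.
apply: (@cube_base_change _ _ _ (set_val (collapse q)) f G
  (fun s => G (s, fun=> zero))) => //.
- apply: (comp_continuous _ cG); apply: pair_continuous; first exact: id_continuous.
  exact: const_continuous.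
- by move=> x; rewrite /G /= ival_zero mulr0 ifT ?invr_ge0 ?ler0n// crush0.
- move=> x; rewrite /G /= ival_one mulr1 ifF; last by apply/negbTE; lra.
  by rewrite (_ : 2 - 1 = 1) ?H1//; lra.
- move=> s x bx; rewrite /G /= (loop_bd f bx) (loop_bd f b0).
  by case: ifP => // _; rewrite (Hq _ _ bx) (Hq _ _ b0).
Qed.

(** Because of the predecessor in [homotopy_group], degree [n.+2] is computed on
    [cube_cuboid R n.+1]. *)
Lemma null_aspherical (Z : uniformType) :
  (forall n (q : Z) (f : loop_space (cube_cuboid R n.+1) q),
    path_joined R f loop_cst) -> aspherical R Z.
Proof.
move=> Zn [|[|n]]// q _ a; rewrite -[a]loop_reprK; apply/loop_classP; exact: Zn.
Qed.

End Aspherical.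

(** * Separability, path connectedness and discreteness *)

Lemma countable_image (T U : Type) (f : T -> U) (A : set T) :
  countable A -> countable (f @` A).
Proof. by move=> cA; apply: sub_countable cA; exact: card_image_le. Qed.

Lemma separable_prod (S T : topologicalType) :
  separable S -> separable T -> separable (S * T)%type.
Proof.
move=> [A cA dA] [B cB dB]; exists (A `*` B); first exact: countableX.
move=> O [[s t] Ost] oO.
have [[U V] /= [Us Vt] UVO] := open_nbhs_nbhs (conj oO Ost).
have [a [Ua Aa]] := dA _ (ex_intro _ s Us) (@open_interior _ U).
have [b [Vb Bb]] := dB _ (ex_intro _ t Vt) (@open_interior _ V).
by exists (a, b); split=> //; apply: UVO; split=> /=; exact: nbhs_singleton.
Qed.

Lemma separable_R (R : realType) : separable R.
Proof.
exists (range ratr); last exact: dense_rat.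
by apply: countable_image; exact: countableP.
Qed.

Lemma separable_R4 (R : realType) : separable (R4 R).
Proof. by do !apply: separable_prod; exact: separable_R. Qed.

Lemma separable_subset (R : realType) (M : pseudoMetricType R) (A : set M) :
  separable M -> separable (set_type A).
Proof.
move=> [D cD dD]; have [[a0]|nA] := pselect (exists a : set_type A, True); last first.
  exists set0 => // O [a _]; by case: nA; exists a.
(* For each centre in [D] and each radius 1/(k+1), one point of [A] in the ball is chosen, or [a0]
   if the ball misses [A]. *)
pose near_pt (z : M * nat) : set_type A :=
  xget a0 [set a | ball z.1 z.2.+1%:R^-1 (set_val a)].
exists (near_pt @` (D `*` setT)).
  by apply: countable_image; apply: countableX => //; exact: countableP.
move=> O [x Ox] oO.
have : nbhs x O by exact: open_nbhs_nbhs.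
rewrite nbhs_ballP => -[e /= e0 xe].
have [k ke] : exists k : nat, k.+1%:R^-1 < e / 2.
  exists (Num.truncn (e / 2)^-1); rewrite -[ltRHS]invrK ltf_pV2 ?posrE//.
  - exact: truncnS_gt.
  - by rewrite invr_gt0 divr_gt0.
have k0 : (0 : R) < k.+1%:R^-1 by rewrite invr_gt0.
have nk : nbhs (set_val x) (ball (set_val x) (k.+1%:R^-1 : R)) by exact: nbhsx_ballx.
have [d [xd Dd]] := dD _ (ex_intro _ (set_val x) nk) (@open_interior _ _).
have {}xd : ball (set_val x) (k.+1%:R^-1 : R) d by exact: nbhs_singleton.
have dn : ball d (k.+1%:R^-1 : R) (set_val (near_pt (d, k))).
  apply: (xgetPex a0 (P := [set a : set_type A | ball d k.+1%:R^-1 (set_val a)])).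
  by exists x; exact: ball_sym.
exists (near_pt (d, k)); split; last by exists (d, k).
apply: xe; rewrite -initial_ballE /=.
apply: (@le_ball _ _ _ (k.+1%:R^-1 + k.+1%:R^-1)).
  by rewrite [leRHS]splitr lerD// ltW.
exact: ball_triangle dn.
Qed.

(** Composition with [phi] is continuous for uniform convergence although [phi] need not be
    uniformly continuous: compactness of [D] makes the local estimates along [f] uniform. *)
Lemma comp_near (R : realType) (D : cuboid R) (Z W : uniformType) (q : Z)
    (phi : Z -> W) (f : loop_space D q) (E : set (W * W)) :
  continuous phi -> entourage E ->
  \forall g \near f, forall x, E (phi (loop_fun f x), phi (loop_fun g x)).
Proof.
move=> cphi entE.
have /compact_near_coveringP := @cuboid_compact R D.
move=> /(_ _ (nbhs f) (fun (g : loop_space D q) x =>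
  E (phi (loop_fun f x), phi (loop_fun g x)))) h.
have {h} : \forall g \near f, [set: D] `<=`
    (fun x => E (phi (loop_fun f x), phi (loop_fun g x))).
  apply: h => x0 _.
  have nE : nbhs (phi (loop_fun f x0))
      [set w | split_ent E (phi (loop_fun f x0), w) /\
               split_ent E (w, phi (loop_fun f x0))].
    rewrite -nbhs_entourageE.
    exists (split_ent E `&` (split_ent E)^-1)%relation; last first.
      by move=> w /xsectionP[].
    exact/entourage_invI/entourage_split_ent.
  have := cphi _ _ nE; rewrite nbhs_simpl /= -nbhs_entourageE => -[B entB BE].
  have nx : \forall x \near x0, split_ent B (loop_fun f x0, loop_fun f x).
    have /cvg_app_entourageP h := @loop_continuous _ _ _ _ f x0.
    exact: (h _ (entourage_split_ent entB)).
  have ng : \forall g \near f, forall x, split_ent B (loop_fun f x, loop_fun g x).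
    have cv : continuous (fun g : loop_space D q => set_val g : {uniform D -> Z}).
      exact: initial_continuous.
    have ux : nbhs (set_val f : {uniform D -> Z})
       [set k | forall y, [set: D] y -> split_ent B (loop_fun f y, k y)].
      apply/uniform_nbhs; exists (split_ent B); split; last by [].
      exact: (entourage_split_ent entB).
    have := cv f _ ux; rewrite nbhs_simpl /=.
    by apply: filterS => g us y; exact: us.
  exists ([set x | split_ent B (loop_fun f x0, loop_fun f x)],
    [set g | forall x, split_ent B (loop_fun f x, loop_fun g x)]) => //.
  move=> [x g] /= [fx gx].
  have Bg : B (loop_fun f x0, loop_fun g x) := entourage_split _ entB fx (gx x).
  have Bf : B (loop_fun f x0, loop_fun f x).
    apply: (entourage_split _ entB fx); apply: entourage_refl.
    exact: entourage_split_ent.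
  have [_ e1] := BE _ ((xsectionP _ _ _).2 Bf).
  have [e2 _] := BE _ ((xsectionP _ _ _).2 Bg).
  exact: (entourage_split _ entE e1 e2).
by apply: filterS => g h x; exact: h.
Qed.

Section PathConnected.
Variable R : realType.
Local Notation Y := (set_type (@bigset R)).
Local Notation X := (set_type (@smallset R)).

Lemma small_path_connected : path_connected R X.
Proof.
suff main (q : X) : path_joined R (base R) q.
  move=> q q'; apply: path_joined_trans (main q'); apply: path_joined_sym.
  exact: main.
have [a qa] := angle_ex q; pose r := rad (set_val (set_val q)).
have r0 : 0 <= r by exact: rad_ge0.
have okr := (angle_polar_ok qa).2.
have ci := @ival_continuous R.
(* The term [s * (1 - s)] keeps the radius positive in between, so the angle may run from 0 to
   [a]. *)
have ok (s : unitI R) :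
    polar_ok (ival s * r + ival s * (1 - ival s)) (ival s * a).
  have /andP[s0 s1] := ival_itv s; set u := ival s.
  have h1 : 0 <= u * r by rewrite mulr_ge0.
  have h2 : 0 <= u * (1 - u) by rewrite mulr_ge0// subr_ge0.
  split; first by rewrite addr_ge0.
  move=> e; have /eqP : u * (1 - u) = 0 by lra.
  rewrite mulf_eq0 subr_eq0 => /orP[/eqP ->|/eqP ue]; first by rewrite mul0r cos0.
  by rewrite -ue mul1r; apply: okr; move: e; rewrite -ue subrr mulr0 addr0 mul1r.
apply/path_joinedP; exists (fun s : unitI R =>
  polar (ival s * r + ival s * (1 - ival s)) (ival s * a)); split.
- apply: polar_continuous => //.
    apply: addf_continuous; apply: mulf_continuous => //; first exact: const_continuous.
    by apply: subf_continuous => //; exact: const_continuous.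
  by apply: mulf_continuous => //; exact: const_continuous.
- apply: small_inj; rewrite polarK// ival_zero !mul0r addr0 cos0 sin0.
  by rewrite /base /=.
- rewrite ival_one subrr mulr0 addr0 !mul1r; exact: polar_angle.
Qed.

Lemma big_path_connected : path_connected R Y.
Proof.
have toX (q : Y) : path_joined R q (set_val (collapse q)).
  apply/path_joinedP; exists (fun s => crush s q); split.
  - have := crush_continuous (unitI_equiconnected R)
      (@const_continuous (unitI R) _ q).
    apply: (@comp_continuous _ _ _ (fun s => (s, s))).
    by apply: pair_continuous; exact: id_continuous.
  - exact: crush0.
  - by rewrite collapseK.
move=> q q'; apply: path_joined_trans (toX q) _.
apply: path_joined_trans (path_joined_sym (toX q')).
have /path_joinedP[h [ch h0 h1]] := small_path_connected (collapse q) (collapse q').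
apply/path_joinedP; exists (fun s => set_val (h s)); split; rewrite ?h0 ?h1//.
exact: set_val_continuous.
Qed.

End PathConnected.

Section Discrete.
Variables (R : realType) (D : cuboid R).
Hypotheses (eD : equiconnected R D) (x0 : D).
Local Notation X := (set_type (@smallset R)).

(** A nearby loop has an angle within a quarter turn of that of [f]. On the boundary the difference
    is a multiple of 2 pi, hence 0, and [angle_joined] applies. *)
Lemma near_joined (q : X) (f : loop_space D q) :
  \forall g \near f, path_joined R f g.
Proof.
have [a [ca fa]] := @angle_lift_small R D x0 _ (@cuboid_compact R D) eD
  (@loop_continuous _ _ _ _ f).
(* Unit vectors whose coordinates differ by less than 1/2 have a scalar product greater than 3/4,
   hence positive. *)
have h : (0 : R) < 2^-1 by [].
have nearE (phi : X -> R) : continuous phi -> \forall g \near f, forall x,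
    `|phi (loop_fun f x) - phi (loop_fun g x)| < 2^-1.
  move=> cphi; have := comp_near f cphi (entourage_ball R (PosNum h)).
  by apply: filterS => g.
have nc := nearE _ (sabscissa_continuous (@id_continuous X)).
have ns := nearE _ (sine_continuous (@id_continuous X)).
apply: filterS2 nc ns => g gc gs.
have cg := @loop_continuous _ _ _ _ g.
have [x|al [cal ac as_ al1]] := @angle_near R D _ _ a
  (sabscissa_continuous cg) (sine_continuous cg) ca (fun x => circleE _).
  have [-> ->] := fa x.
  have := circleE (loop_fun f x); have := circleE (loop_fun g x).
  have := gc x; have := gs x; rewrite !ltr_norml => /andP[? ?] /andP[? ?].
  by nra.
have ga x : angle (loop_fun g x) (a x + al x) by split.
apply: (angle_joined ca (addf_continuous ca cal) fa ga) => x bx.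
have qa : angle q (a x) by rewrite -(loop_bd f bx).
have qb : angle q (a x + al x) by rewrite -(loop_bd g bx).
have := angle_cosB qb qa; rewrite addrAC subrr add0r -cos_norm -cos0.
have pi0 := pi_gt0 R; have := al1 x => {}al1.
move=> /cos_inj; rewrite !in_itv /= normr_ge0 lexx (ltW pi0) /=.
have -> : `|al x| <= pi by lra.
by move=> /(_ isT isT)/normr0_eq0 ->; rewrite addr0.
Qed.

Lemma small_classes_discrete (q : X) (a : loop_classes D q) : open [set a].
Proof.
rewrite loop_classes_openE openE => f /= fa.
by apply: filterS (near_joined f) => g /loop_classP fg; rewrite /= -fg.
Qed.

End Discrete.

(** * Winding numbers and thin loops *)

Section Turns.
Variable R : realType.
Local Notation Y := (set_type (@bigset R)).
Local Notation X := (set_type (@smallset R)).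
Local Notation I := (unitI R).

(* [collapse \o l] is continuous although [collapse] is not. *)
Definition turns (l : I -> Y) (w : R) : Prop := exists a : I -> R,
  [/\ continuous a, forall t, angle (collapse (l t)) (a t) & a one - a zero = w].

(** Two choices of angle differ by a continuous function with values in the multiples of 2 pi. For a
    closed loop the increment is 2 pi times the winding number. *)
Lemma turns_unique (l : I -> Y) (w w' : R) : turns l w -> turns l w' -> w = w'.
Proof.
move=> [a [ca la <-]] [b [cb lb <-]].
have := @cos_eq1_const R (fun t => a t - b t) (subf_continuous ca cb)
  (fun t => angle_cosB (la t) (lb t)).
by lra.
Qed.

(** Lift the angle over the whole square; the increment in [t] is a multiple of 2 pi depending
    continuously on [s]. The homotopy is free, as is needed to treat homotopy equivalences that move
    the base point. *)
Lemma turns_homotopy (H : I * I -> Y) (w : R) : continuous H ->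
  (forall s, H (s, zero) = H (s, one)) ->
  turns (fun t => H (zero, t)) w -> turns (fun t => H (one, t)) w.
Proof.
move=> cH H01 Hw.
have eII := prod_equiconnected (unitI_equiconnected R) (unitI_equiconnected R).
have cII : compact [set: I * I].
  by rewrite -setXTT; apply: compact_setX; exact: unitI_compact.
have [a [ca Ha]] := angle_lift_small (zero, zero) cII eII (collapse_continuous eII cH).
have cfix s : continuous (fun t => a (s, t)).
  apply: (comp_continuous _ ca); apply: pair_continuous; first exact: const_continuous.
  exact: id_continuous.
have cfix' t : continuous (fun s => a (s, t)).
  apply: (comp_continuous _ ca); apply: pair_continuous; last exact: const_continuous.
  exact: id_continuous.
have -> : w = a (zero, one) - a (zero, zero).
  by apply: turns_unique Hw _; exists (fun t => a (zero, t)).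
exists (fun t => a (one, t)); split=> //.
apply/esym/(@cos_eq1_const R (fun s => a (s, one) - a (s, zero))).
  exact: subf_continuous.
by move=> s; apply: (angle_cosB (Ha (s, one))); rewrite -H01.
Qed.

Lemma turns_joined (q : Y) (f g : loop_space (interval_cuboid R) q) (w : R) :
  path_joined R f g -> turns (loop_fun f) w -> turns (loop_fun g) w.
Proof.
move=> /path_joined_homotopyP[H [cH H0 H1 Hq]].
have <- : (fun t => H (zero, t)) = loop_fun f by apply/funext.
have <- : (fun t => H (one, t)) = loop_fun g by apply/funext.
by apply: turns_homotopy => // s; rewrite !Hq//; [right | left].
Qed.

Lemma turns_cst (q : Y) : turns (fun=> q) 0.
Proof.
have [a qa] := angle_ex (collapse q).
by exists (fun=> a); split; [exact: const_continuous | | rewrite subrr].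
Qed.

Lemma base_bigE : set_val (base_big R) = (0, 1, 0, 0).
Proof. by rewrite -[LHS]/(emb 0 1 0) /emb mul0r subrr mul0r. Qed.

(** The thin loop goes out at angle 0 during the first third, makes one turn at constant radius
    during the second, and returns at angle 2 pi during the last. *)
Definition loop_angle (t : I) : R := pi *+ 2 * ival (clamp (3 * ival t - 1)).

(** The inverse of the plateau value is a multiple of 2 pi, so the height vanishes during the
    turn. *)
Definition loop_rad (n : nat) (t : I) : R :=
  (pi *+ 2 *+ n.+1)^-1 * Num.min 1 (Num.min (3 * ival t) (3 * (1 - ival t))).

Lemma loop_angle_continuous : continuous loop_angle.
Proof.
have ci := @ival_continuous R.
apply: mulf_continuous; first exact: const_continuous.
apply: (comp_continuous _ ci); apply: (comp_continuous _ (@clamp_continuous R)).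
apply: subf_continuous; last exact: const_continuous.
by apply: mulf_continuous => //; exact: const_continuous.
Qed.

Lemma loop_rad_continuous n : continuous (loop_rad n).
Proof.
have ci := @ival_continuous R.
apply: mulf_continuous; first exact: const_continuous.
apply: minf_continuous; first exact: const_continuous.
apply: minf_continuous; apply: mulf_continuous => //; try exact: const_continuous.
by apply: subf_continuous => //; exact: const_continuous.
Qed.

Lemma loop_angle_first (t : I) : ival t <= 3^-1 -> loop_angle t = 0.
Proof. by move=> t3; rewrite /loop_angle clamp_le0 ?ival_zero ?mulr0//; lra. Qed.

Lemma loop_angle_last (t : I) : 1 - ival t <= 3^-1 -> loop_angle t = pi *+ 2.
Proof. by move=> t3; rewrite /loop_angle clamp_ge1 ?ival_one ?mulr1//; lra. Qed.

Let eps n : R := (pi *+ 2 *+ n.+1)^-1.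

Let eps_gt0 n : 0 < eps n.
Proof. by rewrite invr_gt0 -mulrnA pmulrn_lgt0 ?pi_gt0. Qed.

Lemma loop_rad_itv n t : 0 <= loop_rad n t <= eps n.
Proof.
have e0 := eps_gt0 n; have t01 := ival_itv t.
rewrite /loop_rad -/(eps n); apply/andP; split.
  apply: mulr_ge0; first exact: ltW.
  by rewrite !le_min ler01 /=; apply/andP; split; lra.
by apply: ler_piMr; [exact: ltW | rewrite ge_min lexx].
Qed.

Lemma loop_cases n t : [\/ loop_angle t = 0, loop_angle t = pi *+ 2 |
  loop_rad n t = eps n].
Proof.
have [t1|t1] := leP (ival t) 3^-1; first by constructor 1; exact: loop_angle_first.
have [t2|t2] := leP (1 - ival t) 3^-1; first by constructor 2; exact: loop_angle_last.
constructor 3; rewrite /loop_rad (min_idPl _) ?mulr1//.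
by rewrite le_min; lra.
Qed.

Lemma loop_polar_ok n t : polar_ok (loop_rad n t) (loop_angle t).
Proof.
split; first by have /andP[] := loop_rad_itv n t.
case: (loop_cases n t) => [->|->|->]; rewrite ?cos0 ?cos2pi// => e.
by have := eps_gt0 n; rewrite e ltxx.
Qed.

Lemma loop_height n t : (1 - cos (loop_angle t)) * sin (loop_rad n t)^-1 = 0.
Proof.
case: (loop_cases n t) => [->|->|->]; rewrite ?cos0 ?cos2pi ?subrr ?mul0r//.
by rewrite invrK -[_ *+ n.+1]add0r (periodicn (@sinD2pi R)) sin0 mulr0//.
Qed.

Lemma cos_loop_angle_bd (t : interval_cuboid R) : bd _ t -> cos (loop_angle t) = 1.
Proof.
case=> ->.
  by rewrite loop_angle_first ?cos0// ival_zero invr_ge0.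
by rewrite loop_angle_last ?cos2pi// ival_one subrr invr_ge0.
Qed.

Lemma loop_polar_bd n (t : interval_cuboid R) : bd _ t ->
  polar (loop_rad n t) (loop_angle t) = base R.
Proof.
move=> bt; have -> : loop_rad n t = 0.
  rewrite /loop_rad (_ : Num.min _ _ = 0) ?mulr0//.
  by case: bt => ->; rewrite ?ival_zero ?ival_one /Order.min;
    do !case: ifPn; rewrite -?leNgt; lra.
have ct := cos_loop_angle_bd bt.
apply: small_inj; rewrite polarK ?ct; last by split.
by rewrite -[RHS]/(set_val (base_big R)) base_bigE /emb mul0r subrr mul0r.
Qed.

Definition small_thin n : loop_space (interval_cuboid R) (base R) :=
  @mk_loop R (interval_cuboid R) X (base R) _
    (polar_continuous (@loop_rad_continuous n) loop_angle_continuous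
    (loop_polar_ok n)) (@loop_polar_bd n).

Definition thin n : loop_space (interval_cuboid R) (base_big R) :=
  @loop_map R _ _ _ (inclusion (@smallset R)) (base R) (small_thin n).

Lemma thin_turns n : turns (loop_fun (thin n)) (pi *+ 2).
Proof.
exists loop_angle; split; first exact: loop_angle_continuous.
  move=> t; rewrite [collapse _]collapse_small; apply: polar_ok_angle.
  exact: loop_polar_ok.
by rewrite loop_angle_last ?loop_angle_first ?subr0 ?ival_one ?ival_zero ?subrr.
Qed.

Lemma arc_big t : @bigset R (0, cos (loop_angle t), 0, 0).
Proof. by apply: segment_big; rewrite cos_geN1 cos_le1. Qed.

Lemma arc_continuous : continuous (fun t => big (0, cos (loop_angle t), 0, 0)).
Proof.
apply: insubd_continuous; last exact: arc_big.
apply: R4_continuous; try exact: const_continuous.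
exact: (comp_continuous loop_angle_continuous (@continuous_cos R)).
Qed.

Lemma arc_bd (t : interval_cuboid R) : bd _ t ->
  big (0, cos (loop_angle t), 0, 0) = base_big R.
Proof.
move=> bt; have ct := cos_loop_angle_bd bt.
apply: big_inj; rewrite bigK; last exact: arc_big.
by rewrite ct base_bigE.
Qed.

(** This is the limit of the thin loops: it has the same abscissa at radius 0, and runs through the
    segment from 1 to -1 and back. *)
Definition arc : loop_space (interval_cuboid R) (base_big R) :=
  @mk_loop R (interval_cuboid R) Y (base_big R) _ arc_continuous arc_bd.

Lemma arc_null : path_joined R arc loop_cst.
Proof.
apply/path_joined_homotopyP; exists (fun z => crush z.1 (loop_fun arc z.2)); split.
- by apply: crush_continuous; [exact: unitI_equiconnected | exact: loop_continuous].
- by move=> t; exact: crush0.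
- move=> t; apply: big_inj; rewrite crushE bigK; last exact: arc_big.
  rewrite /rad /abscissa /ordinate /height /= ltxx ival_one subrr mul0r subr0.
  by rewrite -[RHS]/(set_val (base_big R)) base_bigE.
- move=> s t bt; rewrite loop_bd//; exact: (crush_small s (base R)).
Qed.

(** The abscissas agree and both heights are 0, so the distance between the two loops is at most the
    plateau radius [eps n]. *)
Lemma thin_near_arc (U : set (loop_space (interval_cuboid R) (base_big R))) :
  nbhs arc U -> exists n, U (thin n).
Proof.
move=> [V [[B oB <-] /= Barc] BU].
have /uniform_nbhs[E [entE EB]] := open_nbhs_nbhs (conj oB Barc).
move: entE; rewrite -entourage_from_ballE => -[e /= e0 eE].
have [n ne] : exists n, eps n < e.
  exists (Num.truncn e^-1); rewrite -[e]invrK ltf_pV2 ?posrE ?invr_gt0//.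
  apply: lt_le_trans (truncnS_gt _) _; rewrite -mulrnA -[pi *+ _]mulr_natr natrM.
  have := pi_ge2 R; have : 0 <= (Num.truncn e^-1).+1%:R :> R := ler0n _ _.
  by rewrite invrK; nra.
  by rewrite -mulrnA pmulrn_lgt0 ?pi_gt0.
exists n; apply: BU => /=; apply: EB => t _; apply: eE => /=.
rewrite -[ball _ _ _]/(ball (set_val (loop_fun arc t)) e
  (set_val (loop_fun (thin n) t))).
rewrite bigK; last exact: arc_big.
rewrite [set_val _]polarK; last exact: loop_polar_ok.
have /andP[r0 re] := loop_rad_itv n t.
have r_lt : `|loop_rad n t| < e by rewrite ger0_norm//; exact: le_lt_trans ne.
rewrite /emb loop_height; split; first split; first split => /=.
- by rewrite /ball /= sub0r normrN.
- by rewrite /ball /= subrr normr0.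
- rewrite /ball /= sub0r normrN normrM; apply: le_lt_trans r_lt.
  by rewrite ler_piMr// ler_norml sin_geN1 sin_le1.
- by rewrite /ball /= subrr normr0.
Qed.

Lemma thin_not_null n : ~ path_joined R (thin n) loop_cst.
Proof.
move=> h; have := turns_joined h (thin_turns n).
move=> /turns_unique/(_ (turns_cst (base_big R))) /eqP.
by rewrite mulrn_eq0 /= gt_eqF// pi_gt0.
Qed.

(** * Comparison of the fundamental groups and of the homotopy types *)

Lemma big_classes_not_discrete :
  ~ open [set (1%g : pi1 R (base_big R))].
Proof.
rewrite loop_classes_openE => o1.
(* An open trivial class would contain [arc], and hence some thin loop. *)
have [] := @thin_near_arc [set f | loop_class f = 1%g].
  by apply: open_nbhs_nbhs; split=> //; exact/loop_classP/arc_null.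
by move=> n /loop_classP; exact: thin_not_null.
Qed.

Lemma pi1_not_homeomorphic :
  ~ homeomorphic (pi1 R (base R)) (pi1 R (base_big R)).
Proof.
move=> [f [g [_ cg _ gK]]]; apply: big_classes_not_discrete.
have -> : [set 1%g] = g @^-1` [set g 1%g].
  by apply/seteqP; split=> [_ -> //|c /= /(can_inj gK)].
move/continuousP: cg; apply.
exact: (@small_classes_discrete _ (interval_cuboid R) (unitI_equiconnected R) zero).
Qed.

(** Loops near [g \o arc] are homotopic to it in the smaller space, so for some [n] the images of
    [arc] and [thin n] under [f \o g] have the same winding number, namely 0. Since [f \o g] is
    freely homotopic to the identity, [thin n] would also have winding number 0. *)
Lemma not_homotopy_equivalent : ~ homotopy_equivalent R X Y.
Proof.
move=> [f [g [cf cg _ [H [cH H0 H1]]]]].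
have c2 : continuous (fun z : I * I => z.2) by move=> ?; exact: cvg_snd.
pose gl (l : loop_space (interval_cuboid R) (base_big R)) :
    loop_space (interval_cuboid R) (g (base_big R)) :=
  @mk_loop R (interval_cuboid R) X (g (base_big R)) _
    (comp_continuous (@loop_continuous _ _ _ _ l) cg)
    (fun t bt => congr1 g (loop_bd l bt)).
have [n gn] : exists n, path_joined R (gl arc) (gl (thin n)).
  apply: (@thin_near_arc (fun l => path_joined R (gl arc) (gl l))).
  have [V [[B oB <-] /= Barc] BU] := @near_joined R (interval_cuboid R)
    (unitI_equiconnected R) zero _ (gl arc).
  have /uniform_nbhs[E [entE EB]] := open_nbhs_nbhs (conj oB Barc).
  apply: filterS (comp_near arc cg entE) => l El; apply: BU => /=.
  by apply: EB => t _; exact: El.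
have transport (l : loop_space (interval_cuboid R) (base_big R)) w :
      turns (fun t => f (g (loop_fun l t))) w -> turns (loop_fun l) w.
  move=> lw; have cl := @loop_continuous _ (interval_cuboid R) _ (base_big R) l.
  have -> : loop_fun l = (fun t => H (one, loop_fun l t)).
    by apply/funext => t; rewrite H1.
  apply: (@turns_homotopy (fun z => H (z.1, loop_fun l z.2))).
  - apply: (comp_continuous _ cH); apply: pair_continuous.
      by move=> ?; exact: cvg_fst.
    exact: (comp_continuous c2 cl).
  - by move=> s /=; rewrite !loop_bd//; [right | left].
  - rewrite (_ : (fun t => _) = (fun t => f (g (loop_fun l t))))//.
    by apply/funext => t; rewrite H0.
(* The null-homotopy of [arc] is carried along by [f \o g]. *)
have arc0 : turns (fun t => f (g (loop_fun arc t))) 0.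
  have /path_joined_sym/path_joined_homotopyP[K [cK K0 K1 Kq]] := arc_null.
  have -> : (fun t => f (g (loop_fun arc t))) = (fun t => f (g (K (one, t)))).
    by apply/funext => t; rewrite K1.
  apply: (@turns_homotopy (fun z => f (g (K z)))).
  - exact: (comp_continuous (comp_continuous cK cg) cf).
  - by move=> s; rewrite !Kq//; [right | left].
  - rewrite (_ : (fun t => _) = fun=> f (g (base_big R))); first exact: turns_cst.
    by apply/funext => t; rewrite K0.
have : turns (fun t => f (g (loop_fun (thin n) t))) 0.
  have /path_joined_homotopyP[K [cK K0 K1 Kq]] := gn.
  have -> : (fun t => f (g (loop_fun (thin n) t))) = (fun t => f (K (one, t))).
    by apply/funext => t; rewrite K1.
  apply: (@turns_homotopy (fun z => f (K z))).
  - exact: (comp_continuous cK cf).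
  - by move=> s; rewrite !Kq//; [right | left].
  - rewrite (_ : (fun t => _) = (fun t => f (g (loop_fun arc t)))) //.
    by apply/funext => t; rewrite K0.
move/transport/turns_unique => /(_ _ (thin_turns n)) /eqP.
by rewrite eq_sym mulrn_eq0 /= gt_eqF// pi_gt0.
Qed.

End Turns.

Theorem theorem3 (R : realType) :
  exists (Y : metricType R) (X : set Y) (p : X),
    let j : continuousType X Y := inclusion X in
    [/\ path_connected R X /\ path_connected R Y,
        aspherical R X /\ aspherical R Y & separable X /\ separable Y] /\
    [/\ group_isomorphism (@pi1_map R X Y j p),
        forall n : nat, (1 <= n)%N -> group_isomorphism (@homotopy_group_map R n X Y j p),
        ~ homeomorphic (pi1 R p) (pi1 R (j p)) &
        ~ homotopy_equivalent R X Y].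
Proof.
have sepY : separable (set_type (@bigset R)).
  by apply: separable_subset; exact: separable_R4.
exists (set_type (@bigset R)), (@smallset R), (base R).
split; split.
- by split; [exact: small_path_connected | exact: big_path_connected].
- split; apply: null_aspherical => n q f; [exact: small_null | exact: big_null].
- by split=> //; exact: separable_subset.
- exact/inclusion_isomorphism/unitI_equiconnected.
- by move=> n _; exact/inclusion_isomorphism/cube_equiconnected.
- exact: pi1_not_homeomorphic.
- exact: not_homotopy_equivalent.
Qed.
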